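(* Let $p$ be a density on an interval $I$ fulfilling Assumption (D) (see context), and let $\psi=p'/p$. Let $(W,W')$ be an exchangeable pair of real-valued random variables (with values in $I$ and with the moments below finite) such that $$\mathbb{E}[W'\mid W]=W+\lambda\psi(W)-R(W)$$ for some random variable $R=R(W)$ and $0<\lambda<1$. Then $$\mathbb{E}(W-W')^2=-2\lambda\,\mathbb{E}[W\psi(W)]+2\,\mathbb{E}[W\,R(W)].$$ Moreover, let $Z$ be a random variable distributed according to $p$. Then: (1) Under Assumption (B1), for any uniformly Lipschitz function $h$, $|\mathbb{E}h(W)-\mathbb{E}h(Z)|\le\delta\|h'\|$ with $$\delta:=c_2\,\mathbb{E}\Big|1-\frac1{2\lambda}\mathbb{E}\big((W-W')^2\mid W\big)\Big|+\frac{c_3}{4\lambda}\mathbb{E}|W-W'|^3+\frac{c_1}\lambda\sqrt{\mathbb{E}(R^2)}.$$ (2) Under Assumption (B2), for any $A>0$, \begin{align*} d_{\mathrm K}(W,Z)\le{}&d_2\sqrt{\mathbb{E}\Big(1-\frac1{2\lambda}\mathbb{E}[(W'-W)^2\mid W]\Big)^2}+\Big(d_1+\frac32A\Big)\frac{\sqrt{\mathbb{E}(R^2)}}\lambda\\ &+\frac1\lambda\Big(\frac{d_4A^3}4\Big)+\frac{3A}2\mathbb{E}(|\psi(W)|)+\frac{d_3}{2\lambda}\mathbb{E}\big((W-W')^21_{\{|W-W'|\ge A\}}\big). \end{align*}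
   Context: $(W,W')$ is an exchangeable pair if $(W,W')$ and $(W',W)$ have the same joint law; $R=R(W)$ is a measurable function of $W$; $\|\cdot\|$ is the supremum norm; $d_{\mathrm K}(X,Y)=\sup_{z\in\mathbb{R}}|P(X\le z)-P(Y\le z)|$. Regular functions: let $I$ be a real interval with endpoints $-\infty\le a<b\le\infty$. A function $f$ is regular on $I$ if $f$ is finite on $I$, possesses a right-hand and a left-hand limit at every interior point of $I$, a right-hand limit $f(a+)$ at $a$ and a left-hand limit $f(b-)$ at $b$. Assumption (D): $p$ is a regular, strictly positive probability density on an interval $I=[a,b]$; $p$ has a derivative $p'$ that is regular on $I$, has only countably many sign changes and is continuous at the sign changes; $\int_Ip(x)|\log p(x)|\,dx<\infty$; and $\psi(x):=p'(x)/p(x)$ is regular. Stein equation: write $P(x)=\int_{-\infty}^xp(y)\,dy$ and $P(h)=Ph=\int_Ih(y)p(y)\,dy$. For measurable $h$ with $\int_I|h|p\,dx<\infty$, the equation $f'(x)+\psi(x)f(x)=h(x)-P(h)$ has the solution $f_h(x)=\frac1{p(x)}\int_a^x(h(y)-Ph)p(y)\,dy$. For $h=1_{\{\cdot\le z\}}$ this solution is denoted $f_z$, so $f_z'(x)+\psi(x)f_z(x)=1_{\{x\le z\}}-P(z)$. Assumption (B1): there are constants $c_1,c_2,c_3$ such that for any absolutely continuous $h$, $\|f_h\|\le c_1\|h'\|$, $\|f_h'\|\le c_2\|h'\|$, $\|f_h''\|\le c_3\|h'\|$. Assumption (B2): there are constants $d_1,d_2,d_3,d_4$ such that for all $z$ and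 all real $x,y$, $|f_z(x)|\le d_1$, $|f_z'(x)|\le d_2$, $|f_z'(x)-f_z'(y)|\le d_3$ and $|(\psi(x)f_z(x))'|\le d_4$. *)

(* Defs.v *)
From HB Require Import structures.
From mathcomp Require Import all_boot all_order all_algebra.
From mathcomp Require Import all_classical all_reals all_analysis.
Set Implicit Arguments.
Unset Strict Implicit.
Unset Printing Implicit Defensive.
Import Order.TTheory GRing.Theory Num.Theory.
Import numFieldNormedType.Exports.
Local Open Scope classical_set_scope.
Local Open Scope ring_scope.

(* The endpoints may be infinite; each finite one may or may not belong to I. *)
Definition interval_with_endpoints (R : realType) (a b : \bar R) (I : set R) :=
  [/\ (a < b)%E,
      forall x : R, (a < x%:E)%E -> (x%:E < b)%E -> I x &
      forall x : R, I x -> (a <= x%:E)%E /\ (x%:E <= b)%E].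

(* Limits are taken in \bar R: for the normal density psi x = - x must count
   as regular on ]-oo, +oo[. Finiteness on I is implicit in R -> R. *)
Definition regular (R : realType) (a b : \bar R) (f : R -> R) :=
  [/\ forall x : R, (a <= x%:E)%E -> (x%:E < b)%E ->
        cvg ((f y)%:E @[y --> x^'+]),
      forall x : R, (a < x%:E)%E -> (x%:E <= b)%E ->
        cvg ((f y)%:E @[y --> x^'-]),
      a = -oo%E -> cvg ((f y)%:E @[y --> -oo]) &
      b = +oo%E -> cvg ((f y)%:E @[y --> +oo])].

(* Differentiation relative to I: the usual derivative at interior points of I,
   the one-sided derivative at an endpoint that belongs to I. *)
Definition slope (R : realType) (f : R -> R) (x y : R) : R :=
  (f y - f x) / (y - x).

Definition derivable_in (R : realType) (I : set R) (f : R -> R) (x : R) :=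
  cvg (slope f x y @[y --> within I x^']).

Definition deriv_in (R : realType) (I : set R) (f : R -> R) (x : R) : R :=
  lim (slope f x y @[y --> within I x^']).

Definition sup_norm (R : realType) (I : set R) (f : R -> R) : \bar R :=
  ereal_sup [set `|f x|%:E | x in I].

(* The norm of f' for an f that may fail to be differentiable on a null set. *)
Definition deriv_norm (R : realType) (I : set R) (f : R -> R) : \bar R :=
  ereal_sup [set `|deriv_in I f x|%:E | x in I `&` derivable_in I f].

(* Epsilon-delta absolute continuity on every compact subinterval of I. *)
Definition abs_continuous_in (R : realType) (I : set R) (f : R -> R) :=
  forall u v : R, I u -> I v -> forall e : R, 0 < e ->
  exists2 d : R, 0 < d &
    forall (n : nat) (s t : 'I_n -> R),
      (forall i, u <= s i /\ s i <= t i /\ t i <= v) ->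
      (forall i j, i != j -> t i <= s j \/ t j <= s i) ->
      \sum_(i < n) (t i - s i) < d ->
      \sum_(i < n) `|f (t i) - f (s i)| < e.

Definition sign_change (R : realType) (I : set R) (g : R -> R) (x : R) :=
  I x /\ forall e : R, 0 < e ->
    (exists y, [/\ I y, `|y - x| < e & 0 < g y]) /\
    (exists y, [/\ I y, `|y - x| < e & g y < 0]).

Definition density_on (R : realType) (I : set R) (p : R -> R) :=
  [/\ measurable_fun I p, forall x, I x -> 0 <= p x &
      (\int[lebesgue_measure]_(x in I) (p x)%:E = 1)%E].

Definition score (R : realType) (I : set R) (p : R -> R) (x : R) : R :=
  deriv_in I p x / p x.

Definition assumption_D (R : realType) (a b : \bar R) (I : set R)
    (p : R -> R) :=
  interval_with_endpoints a b I /\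
  [/\ density_on I p, forall x, I x -> 0 < p x & regular a b p] /\
  [/\ forall x, I x -> derivable_in I p x,
      regular a b (deriv_in I p),
      countable (sign_change I (deriv_in I p)) &
      forall x, sign_change I (deriv_in I p) x ->
        deriv_in I p y @[y --> within I (nbhs x)] --> deriv_in I p x] /\
  lebesgue_measure.-integrable I (fun x => (p x * `|ln (p x)|)%:E) /\
  regular a b (score I p).

Definition integrable_against (R : realType) (I : set R) (p h : R -> R) :=
  measurable_fun I h /\
  lebesgue_measure.-integrable I (fun x => (h x * p x)%:E).

Definition density_mean (R : realType) (I : set R) (p h : R -> R) : R :=
  \int[lebesgue_measure]_(y in I) (h y * p y).

Definition stein_solution (R : realType) (I : set R) (p h : R -> R) (x : R) : R
  := (p x)^-1 * \int[lebesgue_measure]_(y in I `&` `]-oo, x])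
                  ((h y - density_mean I p h) * p y).

Definition stein_solution_le (R : realType) (I : set R) (p : R -> R) (z : R) :
    R -> R :=
  stein_solution I p (\1_(`]-oo, z] : set R)).

(* f_z has a kink at z, where f_z' denotes the value prescribed by the Stein
   equation f_z' z + psi z * f_z z = 1 - P z. *)
Definition stein_solution_le_deriv (R : realType) (I : set R) (p : R -> R)
    (z x : R) : R :=
  if x == z then
    1 - density_mean I p (\1_(`]-oo, z] : set R))
      - score I p z * stein_solution_le I p z z
  else deriv_in I (stein_solution_le I p z) x.

(* For h merely absolutely continuous, f_h'' exists only almost everywhere; it
   is the derivative of the absolutely continuous function f_h'. *)
Definition assumption_B1 (R : realType) (I : set R) (p : R -> R)
    (c1 c2 c3 : R) :=
  forall h : R -> R,
    abs_continuous_in I h -> integrable_against I p h ->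
    (deriv_norm I h < +oo)%E ->
    let f := stein_solution I p h in
    let f' := deriv_in I f in
    (sup_norm I f <= c1%:E * deriv_norm I h)%E /\
    [/\ forall x, I x -> derivable_in I f x &
        (sup_norm I f' <= c2%:E * deriv_norm I h)%E] /\
    [/\ abs_continuous_in I f',
        {ae lebesgue_measure, forall x, I x -> derivable_in I f' x} &
        (deriv_norm I f' <= c3%:E * deriv_norm I h)%E].

(* psi * f_z inherits the kink of f_z, hence x != z in the last clause. *)
Definition assumption_B2 (R : realType) (I : set R) (p : R -> R)
    (d1 d2 d3 d4 : R) :=
  forall z : R,
    let f := stein_solution_le I p z in
    let f' := stein_solution_le_deriv I p z in
    let psif := fun x => score I p x * f x in
    [/\ forall x, I x -> `|f x| <= d1,
        forall x, I x -> `|f' x| <= d2,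
        forall x y, I x -> I y -> `|f' x - f' y| <= d3 &
        forall x, I x -> x != z ->
          derivable_in I psif x /\ `|deriv_in I psif x| <= d4].

Definition exchangeable_pair d (T : measurableType d) (R : realType)
    (P : probability T R) (X Y : T -> R) :=
  forall C : set (R * R), measurable C ->
    P [set w | C (X w, Y w)] = P [set w | C (Y w, X w)].

(* V is a version of E[X | Y]. *)
Definition is_cond_expectation d (T : measurableType d) (R : realType)
    (P : probability T R) (Y X V : T -> R) :=
  [/\ P.-integrable setT (EFin \o X), P.-integrable setT (EFin \o V),
      forall B : set R, measurable B ->
        g_sigma_algebra_preimage Y (V @^-1` B) &
      forall A : set T, g_sigma_algebra_preimage Y A ->
        (\int[P]_(w in A) (V w)%:E = \int[P]_(w in A) (X w)%:E)%E].

Definition has_density d (T : measurableType d) (R : realType)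
    (P : probability T R) (Z : {RV P >-> R}) (I : set R) (p : R -> R) :=
  forall B : set R, measurable B ->
    distribution P Z B = (\int[lebesgue_measure]_(x in B `&` I) (p x)%:E)%E.

Definition real_expectation d (T : measurableType d) (R : realType)
    (P : probability T R) (X : T -> R) : R := fine 'E_P[X].

Notation "''Er_' P [ X ]" := (@real_expectation _ _ _ P X%_R)
  (at level 5, P at level 2, format "''Er_' P [ X ]") : ring_scope.

Definition kolmogorov_distance d (T : measurableType d) d'
    (T' : measurableType d') (R : realType)
    (P : probability T R) (Q : probability T' R)
    (X : {RV P >-> R}) (Y : {RV Q >-> R}) : \bar R :=
  ereal_sup [set `|cdf X z - cdf Y z|%E | z in [set: R]].

(* Main.v *)
Require Import Defs.
From HB Require Import structures.
From mathcomp Require Import all_boot all_order all_algebra.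
From mathcomp Require Import all_classical all_reals all_analysis.
From mathcomp Require Import measurable_realfun.
From mathcomp Require Import ring lra.
Set Implicit Arguments.
Unset Strict Implicit.
Unset Printing Implicit Defensive.
Import Order.TTheory GRing.Theory Num.Theory.
Import numFieldNormedType.Exports.
Local Open Scope classical_set_scope.
Local Open Scope ring_scope.

(** Write D for W - W', psi for the score p' / p and S for lambda psi(W) - r(W),
so that E[W' | W] = W + S.  Exchangeability makes E[D (f(W) + f(W'))] vanish for
every bounded f; expanding, and replacing W' by its conditional expectation,
gives [stein_identity]:

  E[D (f(W) - f(W'))] = - 2 E[f(W) S].

Truncating the identity function and passing to the limit turns it into the
formula for E[D^2] ([exchangeable_second_moment]).

Both distance bounds rest on one decomposition.  If f solves the Stein equation
f' + psi f = h - P(h), then E h(W) - P(h) = E[f'(W) + psi(W) f(W)], and the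
identity above rewrites this ([stein_decomposition]) as

  E[f'(W) (1 - V / (2 lambda))] + E[D^2 f'(W) - D (f(W) - f(W'))] / (2 lambda)
    + E[f(W) r(W)] / lambda,

where V is a version of E[D^2 | W].  The two outer terms are bounded by the sup
norms of f' and f and by the Cauchy-Schwarz inequality; only the middle one, a
first-order Taylor remainder multiplied by D, depends on the kind of h.

For Lipschitz h, the remainder is at most half the Lipschitz constant of f'
times |D|^3 ([smooth_bound]).  What is known of f'' holds almost everywhere
only, so one needs that an absolutely continuous function inherits an
almost-everywhere bound on its derivative as a Lipschitz constant
([lipschitz_of_abs_continuous]).  The estimates on f_h are available only for
h integrable against p; that every Lipschitz h qualifies is itself a consequence
of these estimates, applied to truncations of x - x0
([B1_lipschitz_integrable]).

For h the indicator of a half-line ]-oo, z], f is the sum of min(., z) and of a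
function whose derivative - P(z) - psi f is d4-Lipschitz.  When |D| < A the
smooth part contributes at most d4 A^3 / 2 to the middle term, and the kink
contributes at most D^2 on the event that |D| <= A and W lies in an interval of
length A ending or starting at z ([kolmogorov_pointwise]).  That event is
controlled by a concentration inequality, which is the Stein identity again, for
the function of slope 1 around this interval and constant outside
([concentration]).  When |D| >= A the oscillation d3 of f' is used instead.

The Stein equation itself is the fundamental theorem of calculus for f = G / p
with G a primitive of (h - P(h)) p.  The bound d4 on the derivative of psi f is
given away from z only; to carry the Lipschitz estimate across z one needs psi to
be continuous.  It is, because p' has one-sided limits and a derivative has no
jumps ([regular_deriv_continuous]). *)

(** * Integrals determined by weighted laws *)

Import HBNNSimple.

(** The right-hand side involves [Y], [D] and [mu] only through the weighted law
[B |-> \int_(E `&` Y @^-1` B) D].  This is why equality of two such laws extends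
from sets to functions. *)
Lemma integral_nnsfun_comp d1 d2 (T : measurableType d1) (S : measurableType d2)
    (R : realType) (mu : measure T R) (E : set T) (Y : T -> S) (D : T -> R)
    (s : {nnsfun S >-> R}) :
  measurable E -> measurable_fun E Y -> measurable_fun E D ->
  (forall x, E x -> 0 <= D x) ->
  (\int[mu]_(x in E) (s (Y x) * D x)%:E =
   \sum_(r \in range s)
     r%:E * \int[mu]_(x in E `&` Y @^-1` (s @^-1` [set r])) (D x)%:E)%E.
Proof.
move=> mE mY mD D0.
have sY r : (s @^-1` [set r]) !=set0 -> 0 <= r.
  by case=> y /= <-; exact: fun_ge0.
have mind r : measurable_fun E (fun x => \1_(s @^-1` [set r]) (Y x) : R).
  by apply: (measurableT_comp _ mY); exact: measurable_indic.
have mone r : measurable_fun E (fun x => (\1_(s @^-1` [set r]) (Y x) * D x)%:E).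
  by apply/measurable_EFinP; exact: measurable_funM.
transitivity (\int[mu]_(x in E) \sum_(r \in range s)
    (r * (\1_(s @^-1` [set r]) (Y x) * D x))%:E)%E.
  apply: eq_integral => x xE.
  rewrite fimfunE fsumEFin//.
  rewrite mulr_fsuml; congr EFin.
  by apply: eq_fsbigr => r _; rewrite mulrA.
rewrite ge0_integral_fsum//.
- apply: eq_fsbigr => r /set_mem [y _ <-].
  under eq_integral do rewrite EFinM.
  rewrite ge0_integralZl//; last 2 first.
    by move=> x Ex; rewrite lee_fin mulr_ge0// ?D0// indicE ler0n.
    by rewrite lee_fin; exact: fun_ge0.
  congr (_ * _)%E; rewrite integral_mkcondr; apply: eq_integral => x xE.
  rewrite patchE indicE.
  have -> : (x \in Y @^-1` (s @^-1` [set s y])) = (Y x \in s @^-1` [set s y]).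
    by apply/idP/idP; rewrite !inE.
  by case: ifP => _; rewrite ?mul1r ?mul0r.
- by move=> r; apply/measurable_EFinP; apply: measurable_funM => //; exact/measurable_EFinP/mone.
- move=> r x Ex; rewrite lee_fin indicE.
  have [/set_mem/= srx|] := boolP (Y x \in _); last by rewrite mul0r mulr0.
  by rewrite mul1r mulr_ge0// ?D0// -srx; exact: fun_ge0.
Qed.

(** Used for three purposes: exchangeability (laws of two pairs), conditional
expectations (weights [X] and [V] with the same integrals over the events of
[Y]), and densities (the law of [Z] against Lebesgue measure weighted by [p]). *)
Lemma ge0_integral_transfer d1 d2 d3 (T1 : measurableType d1)
    (T2 : measurableType d2) (S : measurableType d3) (R : realType)
    (mu1 : measure T1 R) (mu2 : measure T2 R) (E1 : set T1) (E2 : set T2)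
    (Y1 : T1 -> S) (Y2 : T2 -> S) (D1 : T1 -> R) (D2 : T2 -> R) :
  measurable E1 -> measurable_fun E1 Y1 -> measurable_fun E1 D1 ->
  (forall x, E1 x -> 0 <= D1 x) ->
  measurable E2 -> measurable_fun E2 Y2 -> measurable_fun E2 D2 ->
  (forall x, E2 x -> 0 <= D2 x) ->
  (forall B, measurable B ->
    \int[mu1]_(x in E1 `&` Y1 @^-1` B) (D1 x)%:E =
    \int[mu2]_(x in E2 `&` Y2 @^-1` B) (D2 x)%:E)%E ->
  forall g : S -> R, measurable_fun setT g -> (forall y, 0 <= g y) ->
  (\int[mu1]_(x in E1) (g (Y1 x) * D1 x)%:E =
   \int[mu2]_(x in E2) (g (Y2 x) * D2 x)%:E)%E.
Proof.
move=> mE1 mY1 mD1 D10 mE2 mY2 mD2 D20 H g mg g0.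
have mg' : measurable_fun setT (EFin \o g) by exact/measurable_EFinP.
pose s n := nnsfun_approx measurableT mg' n.
have scvg y : (s n y)%:E @[n --> \oo] --> (g y)%:E.
  by apply: (cvg_nnsfun_approx measurableT mg') => // x _; rewrite lee_fin.
have snd y n m : (n <= m)%N -> s n y <= s m y.
  by move=> nm; exact/lefP/(nd_nnsfun_approx measurableT mg' nm).
have key d' (T : measurableType d') (mu : measure T R) (E : set T) (Y : T -> S)
    (D : T -> R) : measurable E -> measurable_fun E Y -> measurable_fun E D ->
    (forall x, E x -> 0 <= D x) ->
    (\int[mu]_(x in E) (s n (Y x) * D x)%:E @[n --> \oo] -->
     \int[mu]_(x in E) (g (Y x) * D x)%:E)%E.
  move=> mE mY mD D0.
  have -> : (\int[mu]_(x in E) (g (Y x) * D x)%:E =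
     \int[mu]_(x in E) limn (fun n => (s n (Y x) * D x)%:E))%E.
    apply: eq_integral => x xE; apply/esym/cvg_lim => //.
    under eq_fun do rewrite EFinM.
    by rewrite EFinM; exact: cvgeZr.
  apply: cvg_monotone_convergence => //.
  - move=> n; apply/measurable_EFinP; apply: measurable_funM => //.
    exact: measurableT_comp.
  - by move=> n x Ex; rewrite lee_fin mulr_ge0// ?D0//; exact: fun_ge0.
  - by move=> x Ex n m nm; rewrite lee_fin ler_wpM2r ?D0// snd.
have /cvg_unique := key _ _ mu1 _ _ _ mE1 mY1 mD1 D10; apply => //.
rewrite (_ : (fun n => _) = fun n => (\int[mu2]_(x in E2) (s n (Y2 x) * D2 x)%:E)%E).
  exact: key.
apply/funext => n; rewrite !integral_nnsfun_comp//.
by apply: eq_fsbigr => r _; rewrite H.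
Qed.

Lemma integral_transfer d1 d2 d3 (T1 : measurableType d1)
    (T2 : measurableType d2) (S : measurableType d3) (R : realType)
    (mu1 : measure T1 R) (mu2 : measure T2 R) (E1 : set T1) (E2 : set T2)
    (Y1 : T1 -> S) (Y2 : T2 -> S) (D1 : T1 -> R) (D2 : T2 -> R) :
  measurable E1 -> measurable_fun E1 Y1 -> measurable_fun E1 D1 ->
  (forall x, E1 x -> 0 <= D1 x) ->
  measurable E2 -> measurable_fun E2 Y2 -> measurable_fun E2 D2 ->
  (forall x, E2 x -> 0 <= D2 x) ->
  (forall B, measurable B ->
    \int[mu1]_(x in E1 `&` Y1 @^-1` B) (D1 x)%:E =
    \int[mu2]_(x in E2 `&` Y2 @^-1` B) (D2 x)%:E)%E ->
  forall g : S -> R, measurable_fun setT g ->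
  (\int[mu1]_(x in E1) (g (Y1 x) * D1 x)%:E =
   \int[mu2]_(x in E2) (g (Y2 x) * D2 x)%:E)%E /\
  (mu1.-integrable E1 (fun x => (g (Y1 x) * D1 x)%:E) ->
   mu2.-integrable E2 (fun x => (g (Y2 x) * D2 x)%:E)).
Proof.
move=> mE1 mY1 mD1 D10 mE2 mY2 mD2 D20 H g mg.
have tr := ge0_integral_transfer mE1 mY1 mD1 D10 mE2 mY2 mD2 D20 H.
have parts d (T : measurableType d) (mu : measure T R) (E : set T) (Y : T -> S)
    (D : T -> R) : (forall x, E x -> 0 <= D x) ->
    (\int[mu]_(x in E) (g (Y x) * D x)%:E =
     \int[mu]_(x in E) (Num.max (g (Y x)) 0 * D x)%:E -
     \int[mu]_(x in E) (Num.max (- g (Y x)) 0 * D x)%:E)%E.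
  move=> D0; rewrite integralE; congr (_ - _)%E; apply: eq_integral => x /set_mem Ex.
    by rewrite funeposE -EFin_max maxr_pMl ?D0// mul0r.
  by rewrite funenegE -EFinN -EFin_max -mulNr maxr_pMl ?D0// mul0r.
split.
  rewrite !parts//; congr (_ - _)%E.
    apply: (tr (fun y => Num.max (g y) 0)); last by move=> y; rewrite le_max lexx orbT.
    by exact: measurable_maxr.
  apply: (tr (fun y => Num.max (- g y) 0)); last by move=> y; rewrite le_max lexx orbT.
  by apply: measurable_maxr => //; exact: measurableT_comp.
move=> /integrableP[_ fin]; apply/integrableP; split.
  apply/measurable_EFinP; apply: measurable_funM => //.
  exact: measurableT_comp.
rewrite (_ : (\int[mu2]_(x in E2) _)%E = (\int[mu1]_(x in E1) `|(g (Y1 x) * D1 x)%:E|)%E)//.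
transitivity (\int[mu2]_(x in E2) (`|g (Y2 x)| * D2 x)%:E)%E.
  by apply: eq_integral => x /set_mem Ex /=; rewrite normrM (ger0_norm (D20 _ Ex)).
transitivity (\int[mu1]_(x in E1) (`|g (Y1 x)| * D1 x)%:E)%E.
  by apply/esym/(tr (fun y => `|g y|)) => //; exact: measurableT_comp.
by apply: eq_integral => x /set_mem Ex /=; rewrite normrM (ger0_norm (D10 _ Ex)).
Qed.

Lemma probability_inhabited d (T : measurableType d) (R : realType)
    (P : probability T R) : exists w : T, True.
Proof.
apply: contrapT => no; have := probability_setT P.
rewrite (_ : setT = set0) ?measure0; first by move/eqP; rewrite eq_sym onee_eq0.
by apply/seteqP; split => // w _; apply: no; exists w.
Qed.

(** * Exchangeable pairs and the Stein identity *)

Section rv.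
Context d (T : measurableType d) (R : realType) (P : probability T R).
Implicit Types (X Y V f g : T -> R).

Local Notation integrableR X := (P.-integrable setT (fun w => (X w)%:E)).

Lemma integrableR_measurable X : integrableR X -> measurable_fun setT X.
Proof. by move=> /integrableP[/measurable_EFinP]. Qed.

Lemma integrableR_le X Y : measurable_fun setT X -> integrableR Y ->
  (forall w, `|X w| <= `|Y w|) -> integrableR X.
Proof.
move=> mX iY XY; apply: (le_integrable _ _ _ iY) => //.
  exact/measurable_EFinP.
by move=> w _ /=; rewrite lee_fin.
Qed.

Lemma integrableR_cst (k : R) : integrableR (fun=> k).
Proof. exact: finite_measure_integrable_cst. Qed.

Lemma integrableR_bounded X (c : R) : measurable_fun setT X ->
  (forall w, `|X w| <= c) -> integrableR X.
Proof.
move=> mX Xc; apply: (integrableR_le mX (integrableR_cst c)) => w.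
exact: le_trans (Xc w) (ler_norm _).
Qed.

Lemma integrableRM X Y (c : R) : measurable_fun setT X ->
  (forall w, `|X w| <= c) -> integrableR Y -> integrableR (fun w => X w * Y w).
Proof.
move=> mX Xc iY; apply: (integrableR_le (Y := fun w => c * Y w)).
- by apply: measurable_funM => //; exact: integrableR_measurable.
- by under eq_fun do rewrite EFinM; exact: integrableZl.
- move=> w; rewrite !normrM ler_wpM2r//.
  exact: le_trans (Xc w) (ler_norm _).
Qed.

Lemma integrableRD X Y : integrableR X -> integrableR Y ->
  integrableR (fun w => X w + Y w).
Proof. by move=> iX iY; under eq_fun do rewrite EFinD; exact: integrableD. Qed.

Lemma integrableRB X Y : integrableR X -> integrableR Y ->
  integrableR (fun w => X w - Y w).
Proof. by move=> iX iY; under eq_fun do rewrite EFinB; exact: integrableB. Qed.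

Lemma integrableRZ X (k : R) : integrableR X -> integrableR (fun w => k * X w).
Proof. by move=> iX; under eq_fun do rewrite EFinM; exact: integrableZl. Qed.

Lemma integrableR_norm X : integrableR X -> integrableR (fun w => `|X w|).
Proof.
move=> iX; apply: (integrableR_le _ iX) => [|w]; last by rewrite normr_id.
by apply: measurableT_comp => //; exact: integrableR_measurable.
Qed.

Lemma measurable_natb (t : T -> bool) : measurable_fun setT t ->
  measurable_fun setT (fun w => (t w)%:R : R).
Proof.
move=> mt; apply: (measurableT_comp (f := fun u : bool => u%:R : R)) mt.
by move=> _ B _.
Qed.

(** Cauchy-Schwarz against the constant 1, obtained by integrating
[`|X| <= (X ^+ 2 / s + s) / 2] and taking for [s] the root of the second moment. *)
Lemma Rintegral_abs_le_sqrt (X : T -> R) : integrableR X ->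
  integrableR (fun w => X w ^+ 2) ->
  Rintegral P setT (fun w => `|X w|) <=
  Num.sqrt (Rintegral P setT (fun w => X w ^+ 2)).
Proof.
move=> iX iX2; set s2 := Rintegral P setT (fun w => X w ^+ 2).
have s20 : 0 <= s2 by apply: Rintegral_ge0 => w _; exact: sqr_ge0.
have key s : 0 < s -> Rintegral P setT (fun w => `|X w|) <= (s2 / s + s) / 2.
  move=> s0.
  apply: (@le_trans _ _ (Rintegral P setT (fun w => (2 * s)^-1 * X w ^+ 2 + s / 2))).
    apply: le_Rintegral => //.
    - exact: integrableR_norm.
    - by apply: integrableRD; [exact: integrableRZ|exact: integrableR_cst].
    - move=> w _; rewrite -(ler_pM2l (_ : 0 < 2 * s)); last by rewrite mulr_gt0.
      rewrite mulrDr mulVKf; last by rewrite gt_eqF// mulr_gt0.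
      rewrite -(real_normK (num_real (X w))).
      have := sqr_ge0 (`|X w| - s); lra.
  rewrite RintegralD//; [|exact: integrableRZ|exact: integrableR_cst].
  rewrite RintegralZl// Rintegral_cst// [X in fine X]probability_setT /= mulr1.
  by rewrite le_eqVlt; apply/orP; left; apply/eqP; rewrite -/s2; field; rewrite gt_eqF.
(* a zero second moment is reached by letting s tend to 0 instead *)
have [s0|] := ltP 0 (Num.sqrt s2).
  apply: (le_trans (key _ s0)); rewrite -{1}(sqr_sqrtr s20) expr2 mulfK ?gt_eqF//.
  lra.
move=> s0; have s2E : s2 = 0.
  by apply/eqP; rewrite eq_le s20 andbT -sqrtr_eq0 eq_le s0 sqrtr_ge0.
rewrite s2E sqrtr0; apply/ler_addgt0Pr => e e0.
by have := key e e0; rewrite s2E mul0r; lra.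
Qed.

(** Taking out what is known.  [X] and [V] have the same integral over each
event of [Y]; moving negative parts across the equality gives the two
nonnegative weights [X^+ + V^-] and [V^+ + X^-] with the same weighted [Y]-law. *)
Lemma cond_expectation_pull_out Y X V (g : R -> R) (c : R) :
  measurable_fun setT Y -> is_cond_expectation P Y X V ->
  measurable_fun setT g -> (forall y, `|g y| <= c) ->
  \int[P]_w (g (Y w) * X w) = \int[P]_w (g (Y w) * V w).
Proof.
move=> mY [iX iV _ XV] mg gc.
have mX := integrableR_measurable iX; have mV := integrableR_measurable iV.
pose D1 w := Num.max (X w) 0 + Num.max (- V w) 0.
pose D2 w := Num.max (V w) 0 + Num.max (- X w) 0.
have D10 w : 0 <= D1 w by rewrite addr_ge0// le_max lexx orbT.
have D20 w : 0 <= D2 w by rewrite addr_ge0// le_max lexx orbT.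
have iM (U : T -> R) : integrableR U -> integrableR (fun w => Num.max (U w) 0).
  move=> iU; apply: (integrableR_le _ iU).
    apply: measurable_maxr; last exact: measurable_cst.
    exact: integrableR_measurable.
  by move=> w; case: (lerP (U w) 0) => U0 //; rewrite normr0.
have iN (U : T -> R) : integrableR U -> integrableR (fun w => - U w).
  by move=> iU; under eq_fun do rewrite -mulN1r; exact: integrableRZ.
have iD1 : integrableR D1 by apply: integrableRD; apply: iM => //; exact: iN.
have iD2 : integrableR D2 by apply: integrableRD; apply: iM => //; exact: iN.
have D12 w : D1 w - D2 w = X w - V w.
  rewrite /D1 /D2; case: (lerP (X w) 0); case: (lerP (V w) 0);
  case: (lerP (- X w) 0); case: (lerP (- V w) 0); lra.
have RS (B : set T) U : measurable B -> integrableR U -> P.-integrable B (EFin \o U).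
  by move=> mB iU; exact: integrableS iU.
have H B : measurable B -> (\int[P]_(x in setT `&` Y @^-1` B) (D1 x)%:E =
    \int[P]_(x in setT `&` Y @^-1` B) (D2 x)%:E)%E.
  move=> mB; have mA : measurable (setT `&` Y @^-1` B) by exact: mY.
  have XVB : (\int[P]_(w in setT `&` Y @^-1` B) (V w)%:E =
              \int[P]_(w in setT `&` Y @^-1` B) (X w)%:E)%E.
    by apply: XV; exists B.
  have : \int[P]_(x in setT `&` Y @^-1` B) (D1 x - D2 x) = 0.
    under eq_Rintegral do rewrite D12.
    rewrite RintegralB//; [|exact: RS|exact: RS].
    by rewrite /Rintegral XVB subrr.
  rewrite RintegralB//; [|exact: RS|exact: RS].
  move=> /subr0_eq E12.
  rewrite -[LHS]fineK; last by apply: integrable_fin_num => //; exact: RS.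
  rewrite -[RHS]fineK; last by apply: integrable_fin_num => //; exact: RS.
  by congr EFin; exact: E12.
have [+ _] := integral_transfer measurableT mY (integrableR_measurable iD1)
  (fun x _ => D10 x) measurableT mY (integrableR_measurable iD2) (fun x _ => D20 x) H mg.
move=> E; have E' : \int[P]_x (g (Y x) * D1 x) = \int[P]_x (g (Y x) * D2 x).
  by rewrite /Rintegral E.
have mgY : measurable_fun setT (g \o Y) by exact: measurableT_comp.
have igM U : integrableR U -> integrableR (fun w => g (Y w) * U w).
  by move=> iU; exact: (integrableRM mgY (fun w => gc (Y w))).
apply/subr0_eq; rewrite -RintegralB//; [|exact: igM|exact: igM].
under eq_Rintegral do rewrite -mulrBr -D12 mulrBr.
by rewrite RintegralB//; [rewrite E' subrr|exact: igM|exact: igM].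
Qed.

Lemma exchangeable_integral X Y (phi : R * R -> R) :
  measurable_fun setT X -> measurable_fun setT Y -> exchangeable_pair P X Y ->
  measurable_fun setT phi ->
  (\int[P]_w (phi (X w, Y w))%:E = \int[P]_w (phi (Y w, X w))%:E)%E /\
  (integrableR (fun w => phi (X w, Y w)) -> integrableR (fun w => phi (Y w, X w))).
Proof.
move=> mX mY XY mphi.
have H (B : set (R * R)) : measurable B ->
   (\int[P]_(x in setT `&` (fun w => (X w, Y w)) @^-1` B) ((fun=> 1) x)%:E =
    \int[P]_(x in setT `&` (fun w => (Y w, X w)) @^-1` B) ((fun=> 1) x)%:E)%E.
  move=> mB.
  have m1 : measurable_fun setT (fun w => (X w, Y w)) by exact: measurable_fun_pair.
  have m2 : measurable_fun setT (fun w => (Y w, X w)) by exact: measurable_fun_pair.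
  rewrite !integral_cst//; [|exact: m2|exact: m1].
  by rewrite !mul1e !setTI; exact: XY.
have [E J] : (\int[P]_w (phi (X w, Y w) * 1)%:E =
     \int[P]_w (phi (Y w, X w) * 1)%:E)%E /\
    (integrableR (fun w => phi (X w, Y w) * 1) ->
     integrableR (fun w => phi (Y w, X w) * 1)).
  exact: (integral_transfer measurableT (measurable_fun_pair mX mY)
    (@measurable_cst _ _ _ _ setT (1 : R)) (fun _ _ => ler01) measurableT
    (measurable_fun_pair mY mX) (@measurable_cst _ _ _ _ setT (1 : R))
    (fun _ _ => ler01) H mphi).
have e1 : (fun w => (phi (X w, Y w) * 1)%:E) = (fun w => (phi (X w, Y w))%:E).
  by apply/funext => w; rewrite mulr1.
have e2 : (fun w => (phi (Y w, X w) * 1)%:E) = (fun w => (phi (Y w, X w))%:E).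
  by apply/funext => w; rewrite mulr1.
by move: E J; rewrite e1 e2.
Qed.
End rv.

Definition clamp (R : realType) (c x : R) : R := Num.max (- c) (Num.min c x).

Section clamp.
Variable R : realType.
Implicit Types c x y : R.

Lemma clamp_le c x : 0 <= c -> `|clamp c x| <= c.
Proof.
move=> c0; rewrite /clamp ler_norml.
by case: (lerP (- c) (Num.min c x)); case: (lerP c x) => *; lra.
Qed.

Lemma clamp_ge0 c x : 0 <= c -> 0 <= x -> 0 <= clamp c x.
Proof.
move=> c0 x0; rewrite /clamp.
by case: (lerP (- c) (Num.min c x)); case: (lerP c x) => *; lra.
Qed.

Lemma clamp_le0 c x : 0 <= c -> x <= 0 -> clamp c x <= 0.
Proof.
move=> c0 x0; rewrite /clamp.
by case: (lerP (- c) (Num.min c x)); case: (lerP c x) => *; lra.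
Qed.

Lemma clamp_id c x : `|x| <= c -> clamp c x = x.
Proof.
rewrite ler_norml /clamp => /andP[? ?].
by case: (lerP (- c) (Num.min c x)); case: (lerP c x) => *; lra.
Qed.

Lemma clamp_nd c x y : x <= y -> clamp c x <= clamp c y.
Proof.
move=> xy; rewrite /clamp.
by case: (lerP (- c) (Num.min c x)); case: (lerP (- c) (Num.min c y));
   case: (lerP c x); case: (lerP c y) => *; lra.
Qed.

Lemma clamp_lip c x y : x <= y -> clamp c y - clamp c x <= y - x.
Proof.
move=> xy; rewrite /clamp.
by case: (lerP (- c) (Num.min c x)); case: (lerP (- c) (Num.min c y));
   case: (lerP c x); case: (lerP c y) => *; lra.
Qed.

Lemma clamp_dist c x y : `|clamp c x - clamp c y| <= `|x - y|.
Proof.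
wlog xy : x y / y <= x => [H|].
  by have [/H//|/ltW/H] := leP y x; rewrite distrC (distrC y).
by rewrite !ger0_norm ?subr_ge0//; [exact: clamp_lip|exact: clamp_nd].
Qed.

Lemma clamp_norm_nd c c' x : 0 <= c -> c <= c' -> `|clamp c x| <= `|clamp c' x|.
Proof.
move=> c0 cc'; have c'0 := le_trans c0 cc'; have [x0|/ltW x0] := leP 0 x.
  rewrite !ger0_norm ?clamp_ge0// /clamp.
  by case: (lerP (- c) (Num.min c x)); case: (lerP (- c') (Num.min c' x));
   case: (lerP c x); case: (lerP c' x) => *; lra.
rewrite !ler0_norm ?clamp_le0// /clamp.
by case: (lerP (- c) (Num.min c x)); case: (lerP (- c') (Num.min c' x));
   case: (lerP c x); case: (lerP c' x) => *; lra.
Qed.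

Lemma clamp_norm_le c x : 0 <= c -> `|clamp c x| <= `|x|.
Proof.
move=> c0; have := clamp_dist c x 0; rewrite (_ : clamp c 0 = 0) ?subr0//.
by rewrite clamp_id// normr0.
Qed.

Lemma clamp_cvg x : clamp n%:R x @[n --> \oo] --> x.
Proof.
apply: cvg_near_cst; near=> n; rewrite clamp_id//.
by near: n; exact: nbhs_infty_ger.
Unshelve. all: by end_near. Qed.

Lemma measurable_clamp c : measurable_fun setT (clamp c).
Proof.
by apply: measurable_maxr => //; exact: measurable_minr.
Qed.
End clamp.

Section exchangeable.
Context d (T : measurableType d) (R : realType) (P : probability T R).
Variables (W W' S : T -> R).
Hypotheses (mW : measurable_fun setT W) (mW' : measurable_fun setT W').
Hypothesis exch : exchangeable_pair P W W'.
Hypothesis reg : is_cond_expectation P W W' (fun w => W w + S w).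

Local Notation integrableR X := (P.-integrable setT (fun w => (X w)%:E)).

Lemma exchangeable_integrable : integrableR W.
Proof.
have [iW' _ _ _] := reg.
have exch' : exchangeable_pair P W' W by move=> C mC; rewrite exch.
have [_] := exchangeable_integral mW' mW exch' (@measurable_fst _ _ R R).
by apply.
Qed.

Lemma regression_integrable : integrableR S.
Proof.
have [_ iS _ _] := reg.
have := integrableRB iS exchangeable_integrable.
by under eq_fun do rewrite addrAC subrr add0r.
Qed.

(** Exchangeability gives [E[W f(W)] = E[W' f(W')]] and
[E[W f(W')] = E[W' f(W)]], so that the left-hand side is twice
[E[W f(W)] - E[W' f(W)]]; in the last expectation [W'] may be replaced by its
conditional expectation [W + S]. *)
Lemma stein_identity (f : R -> R) (c : R) :
  measurable_fun setT f -> (forall x, `|f x| <= c) ->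
  \int[P]_w ((W w - W' w) * (f (W w) - f (W' w))) =
  - 2 * \int[P]_w (f (W w) * S w).
Proof.
move=> mf fc; have iW := exchangeable_integrable; have iS := regression_integrable.
have [iW' iWS _ _] := reg.
have mfW : measurable_fun setT (f \o W) by exact: measurableT_comp.
have mfW' : measurable_fun setT (f \o W') by exact: measurableT_comp.
have i1 X : integrableR X -> integrableR (fun w => f (W w) * X w).
  by move=> iX; exact: (integrableRM mfW (fun w => fc (W w))).
have i2 X : integrableR X -> integrableR (fun w => f (W' w) * X w).
  by move=> iX; exact: (integrableRM mfW' (fun w => fc (W' w))).
have ex (phi : R * R -> R) : measurable_fun setT phi ->
    \int[P]_w (phi (W w, W' w)) = \int[P]_w (phi (W' w, W w)).
  by move=> mphi; have [E _] := exchangeable_integral mW mW' exch mphi; rewrite /Rintegral E.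
have m1 : measurable_fun setT (fun u : R * R => f u.1).
  exact: measurableT_comp.
transitivity (\int[P]_w ((f (W w) * W w - f (W w) * W' w) +
                         (f (W' w) * W' w - f (W' w) * W w))).
  by apply: eq_Rintegral => w _; ring.
have e1 := ex (fun u => f u.1 * u.1) (measurable_funM m1 (measurable_fst)).
have e2 := ex (fun u => f u.1 * u.2) (measurable_funM m1 (measurable_snd)).
rewrite RintegralD//; [|by apply: integrableRB; [exact: i1|exact: i1]
  |by apply: integrableRB; [exact: i2|exact: i2]].
rewrite !RintegralB//; [|exact: i2|exact: i2|exact: i1|exact: i1].
rewrite /= in e1 e2; rewrite -e1 -e2.
rewrite (cond_expectation_pull_out mW reg mf fc).
under [X in _ - X]eq_Rintegral do rewrite mulrDr.
rewrite RintegralD//; [|exact: i1|exact: i1].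
ring.
Qed.

(** The identity function is not bounded, and [W] need not have a second moment.
Its truncations are admissible in [stein_identity], and both sides converge:
they are dominated by [(W - W') ^+ 2] and by [`|W * S|]. *)
Lemma exchangeable_second_moment :
  integrableR (fun w => (W w - W' w) ^+ 2) -> integrableR (fun w => W w * S w) ->
  \int[P]_w ((W w - W' w) ^+ 2) = - 2 * \int[P]_w (W w * S w).
Proof.
move=> i2 iWS; pose f n := @clamp R n%:R.
have mS := integrableR_measurable regression_integrable.
have mfW n : measurable_fun setT (f n \o W).
  by apply: measurableT_comp => //; exact: measurable_clamp.
have mfW' n : measurable_fun setT (f n \o W').
  by apply: measurableT_comp => //; exact: measurable_clamp.
have c1 : (\int[P]_w ((W w - W' w) * (f n (W w) - f n (W' w)))%:E @[n --> \oo] -->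
           \int[P]_w ((W w - W' w) ^+ 2)%:E)%E.
  apply: (@dominated_cvg _ _ _ P setT measurableT _ _ (fun w => ((W w - W' w) ^+ 2)%:E)) => //.
  - move=> n; apply/measurable_EFinP; apply: measurable_funM.
      exact: measurable_funB.
    exact: (measurable_funB (mfW n) (mfW' n)).
  - move=> w _; apply: cvg_EFin; first exact: nearW.
    apply: cvgM; first exact: cvg_cst.
    by apply: cvgB; exact: clamp_cvg.
  - move=> n w _; rewrite abse_EFin lee_fin normrM -[leRHS]ger0_norm ?sqr_ge0//.
    by rewrite normrX expr2 ler_wpM2l//; exact: clamp_dist.
have c2 : (\int[P]_w (f n (W w) * S w)%:E @[n --> \oo] -->
           \int[P]_w (W w * S w)%:E)%E.
  apply: (@dominated_cvg _ _ _ P setT measurableT _ _ (fun w => `|(W w * S w)%:E|)%E) => //.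
  - by move=> n; apply/measurable_EFinP; exact: (measurable_funM (mfW n) mS).
  - move=> w _; apply: cvg_EFin; first exact: nearW.
    apply: cvgM; last exact: cvg_cst.
    exact: clamp_cvg.
  - exact: integrable_abse.
  - by move=> n w _; rewrite lee_fin !normrM ler_wpM2r// clamp_norm_le.
have iN n : integrableR (fun w => f n (W w) * S w).
  apply: (integrableRM (c := n%:R) (mfW n)) => [w|]; last exact: regression_integrable.
  exact: clamp_le.
have E n : (\int[P]_w ((W w - W' w) * (f n (W w) - f n (W' w)))%:E =
            (- 2)%:E * \int[P]_w (f n (W w) * S w)%:E)%E.
  have := @stein_identity (f n) n%:R (measurable_clamp _) (fun x => clamp_le x (ler0n R n)).
  rewrite /Rintegral => sE; rewrite -[RHS]fineK; last first.
    by rewrite fin_numM//; exact: integrable_fin_num.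
  rewrite fineM//; last exact: integrable_fin_num.
  rewrite -[LHS]fineK; first by congr EFin; exact: sE.
  apply: integrable_fin_num => //; apply: (integrableR_le _ i2).
    apply: measurable_funM; first exact: measurable_funB.
    exact: (measurable_funB (mfW n) (mfW' n)).
  by move=> w; rewrite normrM normrX expr2 ler_wpM2l//; exact: clamp_dist.
have c3 : ((- 2)%:E * \int[P]_w (f n (W w) * S w)%:E @[n --> \oo] -->
           (- 2)%:E * \int[P]_w (W w * S w)%:E)%E by exact: cvgeZl.
move: c1; under eq_fun do rewrite E.
move/(cvg_unique _ c3); rewrite /Rintegral => <- //.
by rewrite fineM//; exact: integrable_fin_num.
Qed.
End exchangeable.

(** * Derivatives relative to an interval *)

Lemma ereal_between (R : realType) (u v : \bar R) : (u < v)%E -> exists x : R, (u < x%:E < v)%E.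
Proof.
case: u v => [u| |] [v| |] //=.
- by rewrite lte_fin => uv; exists ((u + v) / 2); rewrite !lte_fin; apply/andP; split; lra.
- by exists (u + 1); rewrite lte_fin ltry andbT ltrDl.
- by exists (v - 1); rewrite lte_fin ltNyr /= gtrBl.
- by exists 0; rewrite ltNyr ltry.
Qed.

Section interval.
Context (R : realType) (a b : \bar R) (I : set R).
Hypothesis hI : interval_with_endpoints a b I.
Implicit Types (f g : R -> R) (x y t z l m : R).

Lemma interval_conv x y t : I x -> I y -> x <= t -> t <= y -> I t.
Proof.
have [ab sub sup] := hI => Ix Iy; rewrite le_eqVlt => /predU1P[<-//|xt].
rewrite le_eqVlt => /predU1P[->//|ty].
have [ax _] := sup _ Ix; have [_ yb] := sup _ Iy.
by apply: sub; [apply: (le_lt_trans ax)|apply: lt_le_trans yb]; rewrite lte_fin.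
Qed.

Lemma interval_measurable : measurable I.
Proof.
by apply: is_interval_measurable => x y Ix Iy t /andP[]; exact: interval_conv.
Qed.

Lemma interval_interior x y t : I x -> I y -> x < t -> t < y -> nbhs t I.
Proof.
move=> Ix Iy xt ty; have : nbhs t [set` `]x, y[].
  by apply: open_nbhs_nbhs; split; [exact: itv_open|rewrite /= in_itv /= xt ty].
apply: filterS => s; rewrite /= in_itv /= => /andP[/ltW xs /ltW sy].
exact: interval_conv xs sy.
Qed.

Lemma interval_three_points : exists u v w, [/\ I u, I v, I w & u < v < w].
Proof.
have [ab sub sup] := hI.
have [u /andP[au ub]] := ereal_between ab.
have [v /andP[uv vb]] := ereal_between ub.
have [w /andP[vw wb]] := ereal_between vb.
have av := lt_trans au uv; have aw := lt_trans av vw.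
exists u, v, w; split; [exact: sub|exact: sub|exact: sub|].
by move: uv vw; rewrite !lte_fin => -> ->.
Qed.

Lemma interval_other x : I x -> exists2 y, I y & y != x.
Proof.
have [ab sub sup] := hI => Ix.
have [u /andP[au ub]] := ereal_between ab.
have [v /andP[uv vb]] := ereal_between ub.
have [ux|ux] := eqVneq u x; last by exists u => //; exact: sub.
exists v; first by apply: sub => //; exact: lt_trans uv.
by rewrite -ux; move: uv; rewrite lte_fin => uv; rewrite gt_eqF.
Qed.

Lemma interval_near x (e : R) : I x -> 0 < e ->
  exists y, [/\ I y, y != x & `|y - x| < e].
Proof.
move=> Ix e0; have [y Iy yx] := interval_other Ix.
have yx0 : 0 < `|y - x| by rewrite normr_gt0 subr_eq0.
pose k := Num.min 1 (e / 2 / `|y - x|).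
have k0 : 0 < k by rewrite lt_min ltr01 !divr_gt0.
have k1 : k <= 1 by rewrite ge_min lexx.
have ke : k * `|y - x| < e.
  apply: (@le_lt_trans _ _ (e / 2)); last lra.
  by rewrite -ler_pdivlMr// ge_min lexx orbT.
exists (x + k * (y - x)); split.
- have [xy|yx'] := leP x y.
    by apply: (interval_conv Ix Iy); nra.
  by apply: (interval_conv Iy Ix); nra.
- rewrite -subr_eq0 addrC addKr; apply: mulf_neq0; first by rewrite gt_eqF.
  by rewrite subr_eq0.
- by rewrite addrC addKr normrM (gtr0_norm k0).
Qed.

Lemma interval_dnbhs_proper x : I x -> ProperFilter (within I x^').
Proof.
move=> Ix; apply: Build_ProperFilter_ex => A /nbhs_ballP[e /= e0 H].
have [y [Iy yx ye]] := interval_near Ix e0.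
by exists y; apply: (H y) => //; rewrite /ball/= distrC.
Qed.

Lemma deriv_inE f x l : I x ->
  slope f x y @[y --> within I x^'] --> l -> derivable_in I f x /\ deriv_in I f x = l.
Proof.
move=> Ix fl; have ? := interval_dnbhs_proper Ix; split.
  by apply/cvg_ex; exists l.
exact/cvg_lim.
Qed.

Lemma deriv_inP f x : derivable_in I f x ->
  slope f x y @[y --> within I x^'] --> deriv_in I f x.
Proof. by []. Qed.

(** The increment form of differentiability has no quotient and covers interior
points and endpoints alike. *)
Lemma slope_cvgP f x l : (forall e : R, 0 < e -> exists2 d : R, 0 < d &
    forall y, I y -> `|y - x| < d -> `|f y - f x - l * (y - x)| <= e * `|y - x|) <->
  slope f x y @[y --> within I x^'] --> l.
Proof.
split=> [H|].
  apply/cvgrPdist_le => /= e e0; have [d d0 {}H] := H _ e0.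
  apply/nbhs_ballP; exists d => //= y yd yx Iy.
  have yd' : `|y - x| < d by rewrite distrC.
  have := H _ Iy yd'.
  have yx0 : y - x != 0 by rewrite subr_eq0.
  rewrite -ler_pdivrMr ?normr_gt0// => /(le_trans _); apply.
  rewrite -normf_div distrC /slope.
  rewrite (_ : (f y - f x) / (y - x) - l =
    (f y - f x - l * (y - x)) / (y - x))//.
  by field.
move/cvgrPdist_le => H e e0; have /nbhs_ballP[d /= d0 {}H] := H _ e0.
exists d => // y Iy yd; have [->|yx] := eqVneq y x.
  by rewrite !subrr mulr0 subrr normr0 mulr0.
have yx0 : y - x != 0 by rewrite subr_eq0.
have /(_ _ yx Iy) := H y; rewrite /ball/= distrC => /(_ yd).
rewrite distrC -ler_pdivrMr ?normr_gt0//; apply: le_trans.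
rewrite -normf_div /slope.
rewrite (_ : (f y - f x) / (y - x) - l =
  (f y - f x - l * (y - x)) / (y - x))//.
by field.
Qed.

Lemma slope_cvg_continuous f x l : slope f x y @[y --> within I x^'] --> l ->
  f y @[y --> within I (nbhs x)] --> f x.
Proof.
move/slope_cvgP => H; apply/cvgrPdist_le => /= e e0.
have [d d0 {}H] := H 1 ltr01.
have k0 : 0 < 1 + `|l| by rewrite ltr_pwDl.
apply/nbhs_ballP; exists (Num.min d (e / (1 + `|l|))) => /=.
  by rewrite lt_min d0 divr_gt0.
move=> y; rewrite /ball/= distrC lt_min => /andP[yd ye] Iy.
rewrite distrC; have := H _ Iy yd; rewrite mul1r => {}H.
have -> : f y - f x = (f y - f x - l * (y - x)) + l * (y - x) by ring.
rewrite (le_trans (ler_normD _ _))// normrM.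
apply: (@le_trans _ _ ((1 + `|l|) * `|y - x|)).
  by rewrite mulrDl mul1r lerD2r.
by rewrite mulrC -ler_pdivlMr// ltW.
Qed.

Lemma slope_cvg_is_derive f x l : nbhs x I ->
  slope f x y @[y --> within I x^'] --> l -> is_derive x 1 f l.
Proof.
move=> xI H.
have H' : h^-1 *: (f (h *: 1 + x) - f x) @[h --> 0^'] --> l.
  apply/cvgrPdist_le => /= e e0.
  move/cvgrPdist_le : H => /(_ _ e0) /nbhs_ballP[d /= d0 H].
  move: xI => /nbhs_ballP[d' /= d'0 xI].
  apply/nbhs_ballP; exists (Num.min d d') => /=; first by rewrite lt_min d0.
  move=> h; rewrite /ball/= sub0r normrN lt_min => /andP[hd hd'] h0.
  have := H (h + x); rewrite /ball/= opprD addrCA subrr addr0 normrN => /(_ hd).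
  have hx : h + x != x by rewrite -subr_eq0 addrK.
  move=> /(_ hx); rewrite /slope addrK mulrC /GRing.scale /= mulr1; apply.
  by apply: xI; rewrite /ball/= opprD addrCA subrr addr0 normrN.
split; first by apply/cvg_ex; exists l.
exact/cvg_lim.
Qed.

(** The exceptional point [z] is the possible kink of the functions to which the
lemma is applied; the interval is cut there, continuity glues the pieces. *)
Lemma nondecreasing_in f (f' : R -> R) z : {within I, continuous f} ->
  (forall x, I x -> x != z -> slope f x y @[y --> within I x^'] --> f' x) ->
  (forall x, I x -> x != z -> 0 <= f' x) ->
  forall x y, I x -> I y -> x <= y -> f x <= f y.
Proof.
move=> cf df f'0.
have main x y : I x -> I y -> ~ (x < z < y) -> x <= y -> f x <= f y.
  move=> Ix Iy zxy xy.
  have sub t : x <= t -> t <= y -> I t by exact: interval_conv.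
  have cont : {within `[x, y], continuous f}.
    apply: continuous_subspaceW cf => t /=; rewrite in_itv /= => /andP[].
    exact: sub.
  have der t : t \in `]x, y[ -> [/\ I t, t != z & is_derive t 1 f (f' t)].
    rewrite in_itv /= => /andP[xt ty].
    have It : I t by apply: sub; exact: ltW.
    have tz : t != z by apply: contra_notN zxy => /eqP <-; rewrite xt.
    split => //; apply: slope_cvg_is_derive; last exact: df.
    exact: interval_interior xt ty.
  apply: (@ger0_derive1_ndecr _ f x y) => //.
    by move=> t /der[_ _ []].
  move=> t /der[It tz ?]; rewrite derive1E derive_val.
  exact: f'0.
move=> x y Ix Iy xy; have [/andP[xz zy]|/negP] := boolP (x < z < y); last first.
  by move=> ?; exact: main.
have Iz : I z by apply: (interval_conv Ix Iy); exact: ltW.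
apply: (@le_trans _ _ (f z)); apply: main; rewrite ?(ltW xz) ?(ltW zy)//.
  by rewrite ltxx andbF.
by rewrite ltxx.
Qed.

End interval.

Section derivative.
Context (R : realType) (a b : \bar R) (I : set R).
Hypothesis hI : interval_with_endpoints a b I.
Implicit Types (f g : R -> R) (x y t z l m : R).

Lemma mvt_in f (f' : R -> R) x y : I x -> I y -> x < y ->
  (forall t, I t -> slope f t s @[s --> within I t^'] --> f' t) ->
  exists2 t, x < t < y & f y - f x = f' t * (y - x).
Proof.
move=> Ix Iy xy df.
have sub t : x <= t -> t <= y -> I t by exact: (interval_conv hI).
have cf : {within `[x, y], continuous f}.
  have : {within I, continuous f}.
    apply/subspace_continuousP => t It.
    exact: slope_cvg_continuous (df _ It).
  apply: continuous_subspaceW => t /=; rewrite in_itv /= => /andP[].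
  exact: sub.
have der t : t \in `]x, y[ -> is_derive t 1 f (f' t).
  rewrite in_itv /= => /andP[xt ty].
  apply: (@slope_cvg_is_derive _ I).
    exact: (interval_interior hI Ix Iy).
  by apply: df; apply: sub; exact: ltW.
have [t + ->] := MVT xy der cf.
by rewrite in_itv; exists t.
Qed.

(** A derivative has no jumps: by the mean value theorem the slopes at [x] are
values of [f'] at points closer to [x], so a one-sided limit of [f'] at [x],
finite or not, is also the limit of the slopes, that is [f' x]. *)
Lemma regular_deriv_continuous f (f' : R -> R) :
  (forall t, I t -> slope f t s @[s --> within I t^'] --> f' t) ->
  regular a b f' -> {within I, continuous f'}.
Proof.
move=> df [reg_r reg_l _ _]; apply/subspace_continuousP => x Ix.
have [ab sub sup] := hI; have [ax xb] := sup _ Ix.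
have right y : I y -> x < y -> f' t @[t --> x^'+] --> f' x.
  move=> Iy xy; have xb' : (x%:E < b)%E.
    by apply: (@lt_le_trans _ _ y%:E); [rewrite lte_fin|case: (sup _ Iy)].
  have /cvg_ex[L fL] := reg_r x ax xb'.
  suff LE : L = (f' x)%:E by move: fL; rewrite LE => /fine_cvg.
  have sL : (slope f x t)%:E @[t --> x^'+] --> L.
    move=> A /fL /nbhs_ballP[e /= e0 eA].
    apply/nbhs_ballP; exists (Num.min e (y - x)) => /=.
      by rewrite lt_min e0 subr_gt0.
    move=> t; rewrite /ball/= lt_min distrC => /andP[te ty] xt.
    rewrite ltr_norml in ty; rewrite ltr_norml in te.
    have It : I t by apply: (interval_conv hI Ix Iy); lra.
    have [s /andP[xs st] E] := mvt_in Ix It xt df.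
    rewrite /slope E mulfK ?subr_eq0 ?gt_eqF//.
    apply: eA => //; rewrite /ball/= distrC ltr_norml; lra.
  apply/(cvg_unique _ sL) => //.
  apply: cvg_EFin; first exact: nearW.
  move=> A /(df _ Ix) /nbhs_ballP[e /= e0 eA].
  apply/nbhs_ballP; exists (Num.min e (y - x)) => /=.
    by rewrite lt_min e0 subr_gt0.
  move=> t; rewrite /ball/= lt_min => /andP[te ty] xt.
  apply: eA => //=; first by rewrite gt_eqF.
  rewrite distrC ltr_norml in ty.
  by apply: (interval_conv hI Ix Iy); lra.
have left y : I y -> y < x -> f' t @[t --> x^'-] --> f' x.
  move=> Iy yx; have ax' : (a < x%:E)%E.
    by apply: (@le_lt_trans _ _ y%:E); [case: (sup _ Iy)|rewrite lte_fin].
  have /cvg_ex[L fL] := reg_l x ax' xb.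
  suff LE : L = (f' x)%:E by move: fL; rewrite LE => /fine_cvg.
  have sL : (slope f x t)%:E @[t --> x^'-] --> L.
    move=> A /fL /nbhs_ballP[e /= e0 eA].
    apply/nbhs_ballP; exists (Num.min e (x - y)) => /=.
      by rewrite lt_min e0 subr_gt0.
    move=> t; rewrite /ball/= lt_min distrC => /andP[te ty] xt.
    rewrite ltr_norml in ty; rewrite ltr_norml in te.
    have It : I t by apply: (interval_conv hI Iy Ix); lra.
    have [s /andP[xs st] E] := mvt_in It Ix xt df.
    rewrite /slope -opprB E -mulrN opprB mulfK ?subr_eq0 ?lt_eqF//.
    apply: eA => //; rewrite /ball/= distrC ltr_norml; lra.
  apply/(cvg_unique _ sL) => //.
  apply: cvg_EFin; first exact: nearW.
  move=> A /(df _ Ix) /nbhs_ballP[e /= e0 eA].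
  apply/nbhs_ballP; exists (Num.min e (x - y)) => /=.
    by rewrite lt_min e0 subr_gt0.
  move=> t; rewrite /ball/= lt_min => /andP[te ty] xt.
  apply: eA => //=; first by rewrite lt_eqF.
  rewrite distrC ltr_norml in ty.
  by apply: (interval_conv hI Iy Ix); lra.
apply/cvgrPdist_le => /= e e0.
have [d1 d10 H1] : exists2 d, 0 < d & forall y, I y -> x < y -> y - x < d ->
    `|f' x - f' y| <= e.
  have [[y [Iy xy]]|no] := pselect (exists y, I y /\ x < y); last first.
    by exists 1 => // y Iy xy; exfalso; apply: no; exists y.
  have /cvgrPdist_le/(_ _ e0)/nbhs_ballP[d /= d0 H] := right _ Iy xy.
  exists d => // t It xt td; apply: H => //.
  by rewrite /ball/= distrC ltr_norml; lra.
have [d2 d20 H2] : exists2 d, 0 < d & forall y, I y -> y < x -> x - y < d ->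
    `|f' x - f' y| <= e.
  have [[y [Iy xy]]|no] := pselect (exists y, I y /\ y < x); last first.
    by exists 1 => // y Iy xy; exfalso; apply: no; exists y.
  have /cvgrPdist_le/(_ _ e0)/nbhs_ballP[d /= d0 H] := left _ Iy xy.
  exists d => // t It xt td; apply: H => //.
  by rewrite /ball/= ltr_norml; lra.
apply/nbhs_ballP; exists (Num.min d1 d2) => /=; first by rewrite lt_min d10.
move=> t; rewrite /ball/= lt_min !ltr_norml => /andP[t1 t2] It.
have [xt|tx|<-] := ltgtP x t.
- apply: H1 => //; lra.
- apply: H2 => //; lra.
- by rewrite subrr normr0 ltW.
Qed.

Lemma continuous_dnbhs f x : f y @[y --> within I (nbhs x)] --> f x ->
  f y @[y --> within I x^'] --> f x.
Proof.
move=> H A /H /nbhs_ballP[e /= e0 eA]; apply/nbhs_ballP; exists e => // t te _.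
exact: eA.
Qed.

Lemma cvg_slopeM f g x l m :
  slope f x y @[y --> within I x^'] --> l ->
  slope g x y @[y --> within I x^'] --> m ->
  slope (f \* g) x y @[y --> within I x^'] --> l * g x + f x * m.
Proof.
move=> fl gm.
have cg : g y @[y --> within I x^'] --> g x.
  exact/continuous_dnbhs/(slope_cvg_continuous gm).
rewrite (_ : slope _ x = fun y => slope f x y * g y + f x * slope g x y).
  apply: cvgD; first exact: cvgM.
  by apply: cvgM => //; exact: cvg_cst.
by apply/funext => y; rewrite /slope /=; ring.
Qed.

Lemma cvg_slopeV f x l : f x != 0 -> (forall y, I y -> f y != 0) ->
  slope f x y @[y --> within I x^'] --> l ->
  slope (fun y => (f y)^-1) x y @[y --> within I x^'] --> - l / f x ^+ 2.
Proof.
move=> fx0 f0 fl.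
have cf : f y @[y --> within I x^'] --> f x.
  exact/continuous_dnbhs/(slope_cvg_continuous fl).
have : - slope f x y * (f y)^-1 * (f x)^-1 @[y --> within I x^'] --> - l / f x ^+ 2.
  rewrite expr2 invfM mulrA; apply: cvgM; last exact: cvg_cst.
  by apply: cvgM; [exact: cvgN|exact: cvgV].
apply: cvg_trans; apply: near_eq_cvg; near=> y.
have [yx Iy] : y != x /\ I y.
  by near: y; apply/nbhs_ballP; exists 1 => /=.
rewrite /slope; field.
by rewrite fx0 f0 ?subr_eq0 ?yx.
Unshelve. all: by end_near. Qed.

End derivative.

Section primitive.
Context (R : realType) (a b : \bar R) (I : set R).
Hypothesis hI : interval_with_endpoints a b I.
Variable k : R -> R.
Local Notation mu := (@lebesgue_measure R).
Hypothesis ik : mu.-integrable I (EFin \o k).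
Implicit Types (x y t l e : R).

Let mI : measurable I := interval_measurable hI.

Let iS (A : set R) : measurable A -> A `<=` I -> mu.-integrable A (EFin \o k).
Proof. by move=> mA AI; exact: (@integrableS _ _ _ mu _ A _ mI mA AI ik). Qed.

Definition primitive_in x : R := \int[mu]_(t in I `&` `]-oo, x]) k t.

Lemma primitive_in_sub x y : I x -> I y -> x <= y ->
  primitive_in y - primitive_in x = \int[mu]_(t in `]x, y]) k t.
Proof.
move=> Ix Iy xy; have sub : `]x, y] `<=` I.
  move=> t; rewrite /= in_itv /= => /andP[xt ty].
  by apply: (interval_conv hI Ix Iy) => //; exact: ltW.
have E : I `&` `]-oo, y] = (I `&` `]-oo, x]) `|` `]x, y].
  apply/seteqP; split => t /=; rewrite !in_itv /=.
    by move=> [It ty]; have [xt|tx] := ltP x t; [right; rewrite ty|left].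
  move=> [[It tx]|/andP[xt ty]]; first by split => //; exact: le_trans tx xy.
  by split => //; apply: sub; rewrite /= in_itv /= xt.
rewrite /primitive_in E Rintegral_setU//.
- by rewrite addrAC subrr add0r.
- exact: measurableI.
- apply: iS; last by move=> t [[]//|/sub].
  by apply: measurableU => //; exact: measurableI.
- apply/disj_setPS => t /= [[_]]; rewrite !in_itv /= => tx /andP[].
  by rewrite ltNge tx.
Qed.

(** Both the differentiability of a primitive (small [e], [l] the value of the
integrand) and its continuity ([l = 0], [e] a local bound) follow from this
estimate, whose proof integrates [k - l] between [x] and [y]. *)
Lemma primitive_in_bound x y l e : I x -> I y ->
  (forall t, I t -> `|t - x| <= `|y - x| -> `|k t - l| <= e) ->
  `|primitive_in y - primitive_in x - l * (y - x)| <= e * `|y - x|.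
Proof.
have main u v : I u -> I v -> u <= v ->
  (forall t, I t -> u <= t <= v -> `|k t - l| <= e) ->
  `|primitive_in v - primitive_in u - l * (v - u)| <= e * (v - u).
  move=> Iu Iv uv H; rewrite primitive_in_sub//.
  have sub : `]u, v] `<=` I.
    move=> t; rewrite /= in_itv /= => /andP[ut tv].
    by apply: (interval_conv hI Iu Iv) => //; exact: ltW.
  have muv : fine (mu `]u, v]) = v - u.
    rewrite lebesgue_measure_itv /= lte_fin; case: ltP => // vu.
    by rewrite (@le_anti _ _ v u) ?subrr// vu.
  have ikuv : mu.-integrable `]u, v] (EFin \o k) by exact: iS.
  have icst (c : R) : mu.-integrable `]u, v] (EFin \o cst c).
    apply/integrableP; split; first exact/measurable_EFinP.
    rewrite /= integral_cst//= lebesgue_measure_itv/=.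
    by case: ifPn => _; rewrite ?mule0// -EFinD -EFinM ltry.
  have ikl : mu.-integrable `]u, v] (EFin \o (fun t => k t - l)).
    have -> : EFin \o (fun t => k t - l) = ((EFin \o k) \- (EFin \o cst l))%E.
      by apply/funext.
    exact: integrableB.
  have -> : \int[mu]_(t in `]u, v]) k t - l * (v - u) =
            \int[mu]_(t in `]u, v]) (k t - l).
    by rewrite RintegralB//; [rewrite Rintegral_cst// muv|exact: (icst l)].
  rewrite (le_trans (le_normr_Rintegral _ ikl))//.
  rewrite -muv -(@Rintegral_cst _ _ _ mu _ (measurable_itv _) e).
  apply: le_Rintegral => //.
  - by have := integrable_abse ikl.
  - exact: icst.
  - move=> t tuv; apply: H; first exact: sub.
    by move: tuv; rewrite /= in_itv /= => /andP[/ltW -> ->].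
move=> Ix Iy H; have [xy|/ltW yx] := leP x y.
  rewrite (ger0_norm (_ : 0 <= y - x)) ?subr_ge0//; apply: main => // t It /andP[xt ty].
  by apply: H => //; rewrite !ger0_norm ?subr_ge0// lerD2r.
rewrite distrC (distrC y).
rewrite (ger0_norm (_ : 0 <= x - y)) ?subr_ge0//.
have -> : l * (y - x) - (primitive_in y - primitive_in x) =
          primitive_in x - primitive_in y - l * (x - y) by ring.
apply: main => // t It /andP[yt tx].
by apply: H => //; rewrite !ler0_norm ?subr_le0//; lra.
Qed.

Lemma primitive_in_slope x : I x -> k y @[y --> within I (nbhs x)] --> k x ->
  slope primitive_in x y @[y --> within I x^'] --> k x.
Proof.
move=> Ix kx; apply/slope_cvgP => e e0.
move/cvgrPdist_le : kx => /(_ _ e0)/nbhs_ballP[d /= d0 H].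
exists d => // y Iy yd; apply: primitive_in_bound => // t It ty.
by rewrite distrC; apply: H => //; rewrite /ball/= distrC (le_lt_trans ty).
Qed.

Lemma primitive_in_continuous x (c d : R) : I x -> 0 < d ->
  (forall t, I t -> `|t - x| < d -> `|k t| <= c) ->
  primitive_in y @[y --> within I (nbhs x)] --> primitive_in x.
Proof.
move=> Ix d0 H; apply/cvgrPdist_le => /= e e0.
have c0 : 0 <= c by apply: (le_trans _ (H _ Ix _)) => //; rewrite subrr normr0.
have c1 : 0 < c + 1 by rewrite ltr_wpDl.
apply/nbhs_ballP; exists (Num.min d (e / (c + 1))) => /=.
  by rewrite lt_min d0 divr_gt0.
move=> y; rewrite /ball/= distrC lt_min => /andP[yd ye] Iy.
have : `|primitive_in y - primitive_in x - 0 * (y - x)| <= c * `|y - x|.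
  apply: primitive_in_bound => // t It ty; rewrite subr0; apply: H => //.
  exact: le_lt_trans ty yd.
rewrite mul0r subr0 distrC => /le_trans; apply.
move: ye; rewrite ltr_pdivlMr// => ye.
have := normr_ge0 (y - x); nra.
Qed.

End primitive.

(** * The Stein equation *)

Section stein_solution.
Context (R : realType) (a b : \bar R) (I : set R) (p : R -> R).
Hypothesis hD : assumption_D a b I p.
Local Notation mu := (@lebesgue_measure R).
Local Notation psi := (score I p).
Implicit Types (h : R -> R) (x y z t : R).

Let hI : interval_with_endpoints a b I. Proof. by case: hD. Qed.
Let mI : measurable I := interval_measurable hI.

Lemma density_gt0 x : I x -> 0 < p x.
Proof. by have [_ [[_ p0 _] _]] := hD; exact: p0. Qed.

Lemma density_slope x : I x ->
  slope p x y @[y --> within I x^'] --> deriv_in I p x.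
Proof. by have [_ [_ [[dp _ _ _] _]]] := hD => Ix; exact: dp. Qed.

Lemma density_continuous : {within I, continuous p}.
Proof.
apply/subspace_continuousP => x Ix.
exact: slope_cvg_continuous (density_slope Ix).
Qed.

Lemma score_continuous : {within I, continuous psi}.
Proof.
have [_ [_ [[_ rp _ _] _]]] := hD.
have /subspace_continuousP cp' :=
  regular_deriv_continuous hI density_slope rp.
apply/subspace_continuousP => x Ix.
apply: cvgM; first exact: cp'.
apply: cvgV; first by rewrite gt_eqF// density_gt0.
by move/subspace_continuousP : density_continuous; exact.
Qed.

Lemma density_integrable : mu.-integrable I (EFin \o p).
Proof.
have [_ [[[mp p0 p1] _ _] _]] := hD.
apply/integrableP; split; first exact/measurable_EFinP.
rewrite (_ : (\int[mu]_(x in I) _)%E = 1%E) ?ltry// -p1.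
by apply: eq_integral => x /set_mem Ix /=; rewrite ger0_norm// p0.
Qed.

Lemma integrable_against_bounded h (c : R) : measurable_fun I h ->
  (forall x, I x -> `|h x| <= c) -> integrable_against I p h.
Proof.
move=> mh hc; split => //.
have [_ [[[mp p0 _] _ _] _]] := hD.
apply: (@le_integrable _ _ _ mu _ mI _ (fun x => c%:E * (p x)%:E)%E).
- by apply/measurable_EFinP; exact: measurable_funM.
- move=> x Ix; rewrite -EFinM !abse_EFin lee_fin !normrM ler_wpM2r//.
  exact: le_trans (hc _ Ix) (ler_norm _).
- by apply: (@integrableZl _ _ _ mu _ mI _ _ density_integrable).
Qed.

Section solution.
Variable h : R -> R.
Hypothesis ih : integrable_against I p h.
Local Notation m := (density_mean I p h).
Local Notation f := (stein_solution I p h).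

Lemma stein_integrand_integrable :
  mu.-integrable I (EFin \o (fun y => (h y - m) * p y)).
Proof.
have [_ ihp] := ih.
rewrite (_ : EFin \o _ = (fun x => (h x * p x)%:E) \- (fun x => m%:E * (p x)%:E))%E.
  apply: integrableB => //.
  exact: (@integrableZl _ _ _ mu _ mI _ _ density_integrable).
by apply/funext => x; rewrite /= mulrBl EFinB EFinM.
Qed.

(** On [I] the solution is the product of [1 / p] and of a primitive of
[(h - m) * p]; differentiating [1 / p] produces the term with the score. *)
Lemma stein_solution_slope x : I x ->
  h y @[y --> within I (nbhs x)] --> h x ->
  slope f x y @[y --> within I x^'] --> h x - m - psi x * f x.
Proof.
move=> Ix hx; have px := density_gt0 Ix.
have p0 y : I y -> p y != 0 by move=> Iy; rewrite gt_eqF// density_gt0.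
have sG := primitive_in_slope hI stein_integrand_integrable Ix.
have sV := cvg_slopeV (p0 _ Ix) p0 (density_slope Ix).
have cp : p y @[y --> within I (nbhs x)] --> p x.
  by move/subspace_continuousP : density_continuous; exact.
have cG : (h y - m) * p y @[y --> within I (nbhs x)] --> (h x - m) * p x.
  by apply: cvgM => //; apply: cvgB => //; exact: cvg_cst.
have := cvg_slopeM sV (sG cG).
set l := (X in _ --> X -> _) => H.
suff <- : l = h x - m - psi x * f x by exact: H.
rewrite /l /score /stein_solution -/(primitive_in I _ x); field.
by rewrite gt_eqF.
Qed.

Lemma stein_solution_continuous x (c d : R) : I x -> 0 < d ->
  (forall t, I t -> `|t - x| < d -> `|h t| <= c) ->
  f y @[y --> within I (nbhs x)] --> f x.
Proof.
move=> Ix d0 hc; have px := density_gt0 Ix.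
have cp : p y @[y --> within I (nbhs x)] --> p x.
  by move/subspace_continuousP : density_continuous; exact.
apply: cvgM; first by apply: cvgV => //; rewrite gt_eqF.
move/cvgrPdist_le : (cp) => /(_ _ ltr01)/nbhs_ballP[e /= e0 He].
have de0 : 0 < Num.min d e by rewrite lt_min d0.
apply: (primitive_in_continuous hI stein_integrand_integrable Ix de0
  (c := (c + `|m|) * (p x + 1))) => t It.
rewrite lt_min => /andP[td te].
have /(_ _ It) := He t; rewrite /ball/= distrC => /(_ te).
rewrite ler_norml => /andP[pt _]; rewrite normrM.
apply: ler_pM => //; last first.
  rewrite gtr0_norm ?density_gt0//; lra.
rewrite (le_trans (ler_normB _ _))// lerD2r.
exact: hc.
Qed.

Lemma stein_equation x : I x -> h y @[y --> within I (nbhs x)] --> h x ->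
  derivable_in I f x /\ deriv_in I f x = h x - m - psi x * f x.
Proof. by move=> Ix /(stein_solution_slope Ix); exact: (deriv_inE hI). Qed.

End solution.

End stein_solution.

(** * Mean value inequalities *)

Section mean_value.
Context (R : realType) (a b : \bar R) (I : set R).
Hypothesis hI : interval_with_endpoints a b I.
Implicit Types (f g : R -> R) (x y t z l m : R).

Lemma cvg_slopeD f g x l m :
  slope f x y @[y --> within I x^'] --> l ->
  slope g x y @[y --> within I x^'] --> m ->
  slope (fun y => f y + g y) x y @[y --> within I x^'] --> l + m.
Proof.
move=> fl gm; rewrite (_ : slope _ x = fun y => slope f x y + slope g x y).
  exact: cvgD.
by apply/funext => y; rewrite /slope; ring.
Qed.

Lemma cvg_slopeB f g x l m :
  slope f x y @[y --> within I x^'] --> l ->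
  slope g x y @[y --> within I x^'] --> m ->
  slope (fun y => f y - g y) x y @[y --> within I x^'] --> l - m.
Proof.
move=> fl gm; rewrite (_ : slope _ x = fun y => slope f x y - slope g x y).
  exact: cvgB.
by apply/funext => y; rewrite /slope; ring.
Qed.

Lemma cvg_slopeZ (k : R) f x l :
  slope f x y @[y --> within I x^'] --> l ->
  slope (fun y => k * f y) x y @[y --> within I x^'] --> k * l.
Proof.
move=> fl; rewrite (_ : slope _ x = fun y => k * slope f x y).
  by apply: cvgM => //; exact: cvg_cst.
by apply/funext => y; rewrite /slope; ring.
Qed.

Lemma cvg_slope_id x : slope id x y @[y --> within I x^'] --> (1 : R).
Proof.
apply/slope_cvgP => e e0; exists 1 => // y _ _.
by rewrite mul1r subrr normr0 mulr_ge0// ltW.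
Qed.

(** The function [|t - c| (t - c)] is a differentiable odd substitute for the
square: with it, Taylor remainders on both sides of [c] come from one monotone
function. *)
Lemma cvg_slope_sqr_signed (c x : R) :
  slope (fun t => `|t - c| * (t - c)) x y @[y --> within I x^'] --> 2 * `|x - c|.
Proof.
apply/slope_cvgP => e e0; exists e => // y _ ye.
apply: (@le_trans _ _ (`|y - x| * `|y - x|)); last first.
  by rewrite ler_wpM2r// ltW.
have -> : `|y - x| * `|y - x| = (y - x) ^+ 2 by rewrite -expr2 real_normK// num_real.
have -> : y - x = (y - c) - (x - c) by ring.
move: (y - c) (x - c) => E C; rewrite ler_norml.
have := sqr_ge0 E; have := sqr_ge0 C; have := sqr_ge0 (E - C).
have [E0|/ltW E0] := leP 0 E; have [C0|/ltW C0] := leP 0 C;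
  [have := mulr_ge0 E0 C0|have := mulr_ge0_le0 E0 C0
  |have := mulr_le0_ge0 E0 C0|have := mulr_le0 E0 C0];
  rewrite ?(ger0_norm E0) ?(ler0_norm E0) ?(ger0_norm C0) ?(ler0_norm C0) => *;
  by apply/andP; split; lra.
Qed.

Lemma lipschitz_of_deriv f (f' : R -> R) z (M : R) : {within I, continuous f} ->
  (forall x, I x -> x != z -> slope f x y @[y --> within I x^'] --> f' x) ->
  (forall x, I x -> x != z -> `|f' x| <= M) ->
  forall x y, I x -> I y -> `|f y - f x| <= M * `|y - x|.
Proof.
move=> /subspace_continuousP cf df f'M.
have main (s : R) x y : `|s| = 1 -> I x -> I y -> x <= y ->
    s * (f y - f x) <= M * (y - x).
  move=> s1 Ix Iy xy.
  suff : M * x + - s * f x <= M * y + - s * f y by lra.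
  apply: (@nondecreasing_in _ _ _ _ hI (fun t => M * t + - s * f t)
    (fun t => M * 1 + - s * f' t) z) => //.
  - apply/subspace_continuousP => t It; apply: cvgD.
      by apply: cvgM; [exact: cvg_cst|exact: cvg_within].
    by apply: cvgM; [exact: cvg_cst|exact: cf].
  - move=> t It tz; apply: cvg_slopeD; apply: cvg_slopeZ; [exact: cvg_slope_id|exact: df].
  - move=> t It tz /=; have : s * f' t <= M; last by lra.
    by rewrite (le_trans (ler_norm _))// normrM s1 mul1r f'M.
have le1 x y : I x -> I y -> x <= y -> `|f y - f x| <= M * (y - x).
  move=> Ix Iy xy; rewrite ler_norml.
  have := main 1 x y (normr1 _) Ix Iy xy.
  have := main (-1) x y (normrN1 _) Ix Iy xy.
  by move=> *; apply/andP; split; lra.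
move=> x y Ix Iy; have [xy|/ltW yx] := leP x y.
  by rewrite (@ger0_norm _ (y - x)) ?subr_ge0// le1.
by rewrite distrC (distrC y) (@ger0_norm _ (x - y)) ?subr_ge0// le1.
Qed.

(** For [s] equal to 1 or -1, the function
[L / 2 * `|t - x| (t - x) + s f(t) - s f'(x) t] has derivative
[L `|t - x| + s (f'(t) - f'(x)) >= 0]; comparing its values at [x] and [y] for
both signs bounds the remainder on either side of [x]. *)
Lemma taylor_of_lipschitz_deriv f (f' : R -> R) z (L : R) :
  {within I, continuous f} ->
  (forall x, I x -> x != z -> slope f x y @[y --> within I x^'] --> f' x) ->
  (forall x y, I x -> I y -> `|f' y - f' x| <= L * `|y - x|) ->
  forall x y, I x -> I y ->
    `|f y - f x - f' x * (y - x)| <= L / 2 * (y - x) ^+ 2.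
Proof.
move=> /subspace_continuousP cf df f'L x y Ix Iy.
have main (s : R) : `|s| = 1 -> forall u v, I u -> I v -> u <= v ->
    L / 2 * (`|u - x| * (u - x)) + s * f u + - s * f' x * u
    <= L / 2 * (`|v - x| * (v - x)) + s * f v + - s * f' x * v.
  move=> s1; apply: (@nondecreasing_in _ _ _ _ hI
   (fun t => L / 2 * (`|t - x| * (t - x)) + s * f t + - s * f' x * t)
   (fun t => L / 2 * (2 * `|t - x|) + s * f' t + - s * f' x * 1) z).
  - apply/subspace_continuousP => t It; apply: cvgD; last first.
      by apply: cvgM; [exact: cvg_cst|exact: cvg_within].
    apply: cvgD; last by apply: cvgM; [exact: cvg_cst|exact: cf].
    apply: (slope_cvg_continuous (l := L / 2 * (2 * `|t - x|))).
    by apply: cvg_slopeZ; exact: cvg_slope_sqr_signed.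
  - move=> t It tz; apply: cvg_slopeD; last by apply: cvg_slopeZ; exact: cvg_slope_id.
    apply: cvg_slopeD; apply: cvg_slopeZ; last exact: df.
    exact: cvg_slope_sqr_signed.
  - move=> t It tz /=; have : - s * (f' t - f' x) <= L * `|t - x|; last by lra.
    by rewrite (le_trans (ler_norm _))// normrM normrN s1 mul1r f'L.
have [xy|/ltW yx] := leP x y.
  have := main 1 (normr1 _) _ _ Ix Iy xy.
  have := main (-1) (normrN1 _) _ _ Ix Iy xy.
  rewrite subrr normr0 (@ger0_norm _ (y - x)) ?subr_ge0// => *.
  by rewrite ler_norml; apply/andP; split; nra.
have := main 1 (normr1 _) _ _ Iy Ix yx.
have := main (-1) (normrN1 _) _ _ Iy Ix yx.
rewrite subrr normr0 (@ler0_norm _ (y - x)) ?subr_le0// => *.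
by rewrite ler_norml; apply/andP; split; nra.
Qed.

End mean_value.

(** * Absolute continuity and almost everywhere bounds on the derivative *)

(** Continuous induction: the supremum of the points of [S] can be passed as long
as it is below [v]. *)
Lemma interval_induction (R : realType) (u v : R) (S : set R) : u <= v -> S u ->
  (forall x, u <= x -> x <= v -> exists2 d, 0 < d & forall c c', S c -> u <= c ->
     x - d < c -> c <= x -> x <= c' -> c' < x + d -> c' <= v -> S c') ->
  S v.
Proof.
move=> uv Su step; pose E := [set c | u <= c /\ c <= v /\ S c].
have Eu : E u by [].
have supE : has_sup E by split; [exists u|exists v => c [_ []]].
have ux : u <= sup E by apply: sup_ubound => //; case: supE.
have xv : sup E <= v by apply: ge_sup => [|c [_ []]//]; exists u.
have [d d0 H] := step _ ux xv.
have [c [uc [cv Sc]] dc] := sup_adherent d0 supE.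
have cx : c <= sup E by apply: sup_ubound => //; case: supE.
have up c' : sup E <= c' -> c' < sup E + d -> c' <= v -> S c'.
  by move=> *; apply: (H c c').
have [xv'|vx] := ltP (sup E) v; last first.
  by apply: up => //; rewrite (le_lt_trans (_ : _ <= sup E))// ltrDl.
pose c' := Num.min v (sup E + d / 2).
have c'v : c' <= v by rewrite ge_min lexx.
have xc' : sup E < c' by rewrite lt_min xv' ltrDl divr_gt0.
have c'd : c' <= sup E + d / 2 by rewrite ge_min lexx orbT.
have : c' <= sup E.
  apply: sup_ubound; first by case: supE.
  split; first by rewrite (le_trans ux)// ltW.
  by split => //; apply: up => //; lra.
by rewrite leNgt xc'.
Qed.

Section absolute_continuity.
Context (R : realType) (a b : \bar R) (I : set R).
Hypothesis hI : interval_with_endpoints a b I.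
Implicit Types (g : R -> R) (x y t z l m : R).
Local Notation mu := (@lebesgue_measure R).

(** Cover the null set where [g] is not differentiable by an open set [G] of
measure less than the modulus [d] of absolute continuity for [e].  Moving from
[u] to the right, a step around a point of differentiability increases [g] by at
most [M + e] times its length, and a step around a point of the null set is an
interval inside [G].  The intervals of the second kind have total length less
than [d], hence they contribute at most [e] in total. *)
Lemma lipschitz_of_abs_continuous g (M : R) : abs_continuous_in I g ->
  {ae mu, forall x, I x -> derivable_in I g x} ->
  (forall x, I x -> derivable_in I g x -> `|deriv_in I g x| <= M) ->
  forall x y, I x -> I y -> `|g y - g x| <= M * `|y - x|.
Proof.
move=> acg [N [mN N0 subN]] gM.
suff main u v : I u -> I v -> u <= v -> `|g v - g u| <= M * (v - u).
  move=> x y Ix Iy; have [xy|/ltW yx] := leP x y.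
    by rewrite (@ger0_norm _ (y - x)) ?subr_ge0// main.
  by rewrite distrC (distrC y) (@ger0_norm _ (x - y)) ?subr_ge0// main.
move=> Iu Iv uv.
suff eps e : 0 < e -> `|g v - g u| <= (M + e) * (v - u) + e.
  apply/ler_addgt0Pr => e e0.
  have k0 : 0 < v - u + 1 by rewrite ltr_wpDl ?subr_ge0.
  have := eps (e / (v - u + 1)) (divr_gt0 e0 k0).
  have E : e / (v - u + 1) * (v - u + 1) = e by rewrite divfK ?gt_eqF.
  by nra.
have [uv'|vu] := ltP u v; last first.
  by move=> e0; rewrite (@le_anti _ _ u v) ?uv// !subrr normr0 mulr0 add0r ltW.
have M0 : 0 <= M.
  have [x [/andP[ux xv] nNx]] : exists x, u <= x <= v /\ ~ N x.
    apply: contrapT => no; suff : (mu `[u, v] <= mu N)%E.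
      rewrite [X in (_ <= X)%E]N0 lebesgue_measure_itv/= lte_fin uv'.
      by rewrite -EFinD lee_fin subr_le0 leNgt uv'.
    apply: le_measure; rewrite ?inE// => x /=; rewrite in_itv /= => uxv.
    by apply: contrapT => nNx; apply: no; exists x.
  have Ix : I x by exact: (interval_conv hI Iu Iv).
  apply: le_trans (gM _ Ix _); first exact: normr_ge0.
  by apply: contrapT => ndx; apply: nNx; apply: subN => /=; apply: contra_not ndx; exact.
move=> e0; have [d d0 H] := acg u v Iu Iv e e0.
have [G [oO NO ON]] : exists U : set R, [/\ open U, N `<=` U &
    (mu (U `\` N) < d%:E)%E].
  by apply: lebesgue_regularity_outer => //; rewrite [X in (X < _)%E]N0.
have mO : measurable G by exact: open_measurable.
have Od : (mu G < d%:E)%E.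
  rewrite (_ : G = (G `\` N) `|` N); last by rewrite setUC setDUK.
  apply: le_lt_trans (measureU2 _ _ _) _ => //; first exact: measurableD.
  by rewrite /= [X in (_ + X)%E]N0 adde0.
(* the intervals ]s i, t i[ are the steps made so far around points of N *)
pose S c := exists (n : nat) (s t : nat -> R),
  [/\ forall i, (i < n)%N -> u <= s i /\ s i <= t i /\ t i <= c,
      forall i j, (i < j < n)%N -> t i <= s j,
      ((\sum_(i < n) (t i - s i))%:E <= mu (G `&` `[u, c]))%E &
      `|g c - g u| <= (M + e) * (c - u) + \sum_(i < n) `|g (t i) - g (s i)|].
have Sv : S v.
  apply: (interval_induction uv).
    exists 0%N, (fun=> 0), (fun=> 0); split => //.
      by rewrite big_ord0 measure_ge0.
    by rewrite big_ord0 !subrr normr0 mulr0 addr0.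
  move=> x ux xv; have Ix : I x by exact: (interval_conv hI Iu Iv).
  have [Nx|nNx] := pselect (N x).
    have /nbhs_ballP[r /= r0 rO] : nbhs x G by apply: open_nbhs_nbhs; split => //; exact: NO.
    exists r => // c c' [n [s [t [st1 st2 st3 st4]]]] uc cx1 cx2 xc1 xc2 cv'.
    exists n.+1, (fun i => if i == n then c else s i), (fun i => if i == n then c' else t i).
    have cc' : c <= c' by exact: le_trans cx2 xc1.
    split.
    - move=> i; rewrite ltnS leq_eqVlt; case: eqP => [_ _|_ /= iltn]//.
      have [? [? tc]] := st1 _ iltn; split => //; split => //.
      exact: le_trans tc cc'.
    - move=> i j /andP[ij]; rewrite ltnS leq_eqVlt; case: eqP => [jn _|jn /= jltn].
        rewrite jn in ij; rewrite ltn_eqF//.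
        by have [_ []] := st1 _ ij.
      rewrite ltn_eqF ?(ltn_trans ij)//.
      by apply: st2; rewrite ij.
    - rewrite big_ord_recr /= eqxx.
      under eq_bigr => i _ do rewrite ltn_eqF//.
      rewrite EFinD.
      have E : G `&` `[u, c'] = (G `&` `[u, c]) `|` `]c, c'].
        apply/seteqP; split => y /=; rewrite !in_itv /=.
          move=> [Oy /andP[uy yc']]; have [cy|yc] := ltP c y; first by right; rewrite yc'.
          by left; rewrite uy.
        move=> [[Oy /andP[uy yc]]|/andP[cy yc']].
          by rewrite uy (le_trans yc).
        split; last by rewrite yc' (le_trans uc (ltW cy)).
        by apply: rO; rewrite /ball/= ltr_norml; lra.
      rewrite E measureU//.
      + apply: leeD => //.
        rewrite /= lebesgue_measure_itv /= lte_fin; case: ltP => // c'c.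
        by rewrite lee_fin subr_le0.
      + exact: measurableI.
      + apply/seteqP; split => y //= [[_]]; rewrite !in_itv /= => /andP[_ yc].
        by rewrite ltNge yc.
    - rewrite big_ord_recr /= eqxx.
      under eq_bigr => i _ do rewrite ltn_eqF//.
      have -> : g c' - g u = (g c - g u) + (g c' - g c) by ring.
      rewrite (le_trans (ler_normD _ _))// addrA lerD2r (le_trans st4)// lerD2r.
      by rewrite ler_wpM2l ?lerD2r// addr_ge0// ltW.
  have dx : derivable_in I g x.
    apply: contrapT => ndx; apply: nNx; apply: subN => /= ; apply: contra_not ndx.
    exact.
  have /slope_cvgP := deriv_inP dx.
  move=> /(_ e e0)[r r0 Hr]; exists r => //.
  move=> c c' [n [s [t [st1 st2 st3 st4]]]] uc cx1 cx2 xc1 xc2 cv'.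
  have cc' : c <= c' by exact: le_trans cx2 xc1.
  have lip y : I y -> `|y - x| < r -> `|g y - g x| <= (M + e) * `|y - x|.
    move=> Iy yr; have Hy := Hr _ Iy yr; have Mx := gM _ Ix dx.
    have -> : g y - g x = (g y - g x - deriv_in I g x * (y - x)) + deriv_in I g x * (y - x).
      by ring.
    rewrite (le_trans (ler_normD _ _))// mulrDl addrC lerD// normrM ler_wpM2r//.
  exists n, s, t; split => //.
  - move=> i iltn; have [? [? tc]] := st1 _ iltn; split => //; split => //.
    exact: le_trans tc cc'.
  - apply: (le_trans st3); apply: le_measure; rewrite ?inE//.
    + exact: measurableI.
    + exact: measurableI.
    + by move=> y /= [Oy]; rewrite !in_itv /= => /andP[-> yc]; rewrite (le_trans yc).
  - have Ic : I c by apply: (interval_conv hI Iu Iv) => //; rewrite (le_trans cx2).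
    have Ic' : I c' by apply: (interval_conv hI Iu Iv) => //; rewrite (le_trans ux).
    have l1 := lip c Ic; have l2 := lip c' Ic'.
    have -> : g c' - g u = (g c - g u) + (g x - g c) + (g c' - g x) by ring.
    rewrite (le_trans (ler_normD _ _))// (le_trans (lerD (ler_normD _ _) (lexx _)))//.
    rewrite [`|g x - _|]distrC.
    have l1' : `|g c - g x| <= (M + e) * (x - c).
      have := l1; rewrite (@ler0_norm _ (c - x)) ?subr_le0// opprB.
      by apply; lra.
    have l2' : `|g c' - g x| <= (M + e) * (c' - x).
      have := l2; rewrite (@ger0_norm _ (c' - x)) ?subr_ge0//.
      by apply; lra.
    nra.
have [n [s [t [st1 st2 st3 st4]]]] := Sv.
apply: (le_trans st4); rewrite lerD2l ltW//; apply: H.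
- by move=> i; exact: st1.
- move=> i j ij; have [ltij|ltji|/val_inj eij] := ltngtP i j.
  + by left; apply: st2; rewrite ltij ltn_ord.
  + by right; apply: st2; rewrite ltji ltn_ord.
  + by rewrite eij eqxx in ij.
- rewrite -lte_fin (le_lt_trans st3)// (le_lt_trans _ Od)//.
  apply: le_measure; rewrite ?inE//.
  exact: measurableI.
Qed.

End absolute_continuity.

(** * Expectations of functions of Z *)

(** Neither function is required to be measurable: a simple function below [f]
may be replaced by 0 on [N] without changing its integral, and is then below
[g].  A test function is only controlled on [I], while [Z] lies in [I] almost
surely only. *)
Lemma eq_integral_off_null d (T : measurableType d) (R : realType)
    (mu : measure T R) (N : set T) (f g : T -> \bar R) :
  measurable N -> mu N = 0%E -> (forall x, ~ N x -> f x = g x) ->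
  (\int[mu]_x f x = \int[mu]_x g x)%E.
Proof.
move=> mN N0 fg.
have le (u v : T -> \bar R) : (forall x, 0 <= u x)%E -> (forall x, 0 <= v x)%E ->
    (forall x, ~ N x -> u x = v x) -> (\int[mu]_x u x <= \int[mu]_x v x)%E.
  move=> u0 v0 uv; rewrite ge0_integralTE// [leRHS]ge0_integralTE//.
  apply: ge_ereal_sup => _ /= [s su <-].
  rewrite -integralT_nnsfun.
  pose s' := proj_nnsfun s (measurableC mN).
  have s'E x : s' x = (s \_ (~` N)) x by rewrite /s' -mrestrict.
  have -> : (\int[mu]_x (s x)%:E = \int[mu]_x (s' x)%:E)%E.
    apply: ae_eq_integral => //.
    - exact/measurable_EFinP.
    - exact/measurable_EFinP.
    - exists N; split => // x /= H; apply: contrapT => nNx; apply: H => _.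
      have e : (s \_ (~` N)) x = s x by rewrite patchE mem_set.
      exact: (congr1 EFin (etrans (esym e) (esym (s'E x)))).
  rewrite integralT_nnsfun; apply: ereal_sup_ubound; exists s' => // x.
  rewrite (s'E x) patchE; have [Nx|nNx] := pselect (N x).
    by rewrite memNset.
  by rewrite mem_set// -uv.
have eq (u v : T -> \bar R) : (forall x, 0 <= u x)%E -> (forall x, 0 <= v x)%E ->
    (forall x, ~ N x -> u x = v x) -> (\int[mu]_x u x = \int[mu]_x v x)%E.
  by move=> u0 v0 uv; apply/eqP; rewrite eq_le !le// => x nNx; rewrite uv.
by rewrite integralE [RHS]integralE; congr (_ - _)%E; apply: eq => // x nNx;
  rewrite ?funeposE ?funenegE fg.
Qed.

Section density.
Context d (T : measurableType d) (R : realType) (Q : probability T R).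
Variables (Z : {RV Q >-> R}) (a b : \bar R) (I : set R) (p : R -> R).
Hypotheses (hD : assumption_D a b I p) (hZ : has_density Z I p).
Local Notation mu := (@lebesgue_measure R).

Lemma integral_has_density (h : R -> R) : measurable_fun I h ->
  (\int[Q]_w (h (Z w))%:E = \int[mu]_(x in I) (h x * p x)%:E)%E.
Proof.
move=> mh; have [hI [[[mp p0 p1] _ _] _]] := hD.
have mI : measurable I := interval_measurable hI.
have mZ : measurable_fun setT Z by [].
have mhI : measurable_fun setT (h \_ I) by apply/(measurable_restrictT _ mI).
transitivity (\int[Q]_w ((h \_ I) (Z w) * cst 1 w)%:E)%E.
  apply: (@eq_integral_off_null _ _ _ _ (Z @^-1` (~` I))).
  - by rewrite -[X in measurable X]setTI; apply: mZ => //; exact: measurableC.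
  - transitivity (distribution Q Z (~` I)) => //.
    rewrite hZ; last exact: measurableC.
    by rewrite setICl integral_set0.
  - move=> w /=; rewrite mulr1 patchE => /contrapT Iz.
    by rewrite mem_set.
transitivity (\int[mu]_(x in I) ((h \_ I) x * p x)%:E)%E; last first.
  by apply: eq_integral => x xI; rewrite patchE xI.
have H (B : set R) : measurable B -> (\int[Q]_(w in setT `&` Z @^-1` B) (cst 1 w)%:E =
    \int[mu]_(x in I `&` id @^-1` B) (p x)%:E)%E.
  move=> mB; rewrite preimage_id [in RHS]setIC -hZ//.
  rewrite -[LHS]/(\int[Q]_(w in setT `&` Z @^-1` B) cst 1 w)%E.
  rewrite integral_cst ?mul1e ?setTI//.
  by rewrite -[X in measurable X]setTI; exact: mZ.
by have [] := @integral_transfer _ _ _ _ _ _ R Q mu setT I Z id (cst 1) p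
  measurableT mZ (@measurable_cst _ _ _ _ _ (1 : R)) (fun _ _ => ler01)
  mI (@measurable_id _ _ _) mp p0 H _ mhI.
Qed.

End density.

(** * Indicators of half-lines *)

Section kolmogorov_pointwise.
Context (R : realType) (a b : \bar R) (I : set R) (p : R -> R).
Variables (d1 d2 d3 d4 z : R).
Hypotheses (hD : assumption_D a b I p) (hB : assumption_B2 I p d1 d2 d3 d4).
Local Notation psi := (score I p).
Local Notation h := (\1_(`]-oo, z] : set R) : R -> R).
Local Notation m := (density_mean I p h).
Local Notation f := (stein_solution_le I p z).
Local Notation f1 := (stein_solution_le_deriv I p z).
Implicit Types x y t : R.

Let hI : interval_with_endpoints a b I. Proof. by case: hD. Qed.
Let mI : measurable I := interval_measurable hI.

Lemma indic_rayE x : h x = (x <= z)%R%:R.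
Proof.
rewrite indicE; have -> // : (x \in [set` `]-oo, z]]) = (x <= z).
by apply/idP/idP; rewrite inE /= in_itv.
Qed.

Lemma indic_ray_le1 x : `|h x| <= 1.
Proof. by rewrite indic_rayE normr_nat lern1 leq_b1. Qed.

Lemma indic_ray_integrable : integrable_against I p h.
Proof.
apply: (integrable_against_bounded hD (c := 1)) => [|x _].
  exact: measurable_indic.
exact: indic_ray_le1.
Qed.

Lemma near_ne x : x != z -> exists2 d : R, 0 < d &
  forall t, `|t - x| < d -> t != z /\ (t <= z) = (x <= z).
Proof.
move=> xz; exists `|x - z|; first by rewrite normr_gt0 subr_eq0.
move=> t; move: xz; rewrite neq_lt => /orP[xz|zx].
  rewrite (@ltr0_norm _ (x - z)) ?subr_lt0// ltr_norml => /andP[_ tz].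
  have {}tz : t < z by lra.
  by rewrite lt_eqF// !ltW.
rewrite (@gtr0_norm _ (x - z)) ?subr_gt0// ltr_norml => /andP[tz _].
have {}tz : z < t by lra.
by rewrite gt_eqF// !leNgt tz zx.
Qed.

Lemma indic_ray_continuous x : x != z -> h y @[y --> within I (nbhs x)] --> h x.
Proof.
move=> /near_ne[d d0 H]; apply: cvg_near_cst; apply/nbhs_ballP.
exists d => //= t; rewrite /ball/= distrC => /H[_ E] _.
by rewrite !indic_rayE E.
Qed.

(** At the kink [z] the formula is the convention defining [f1 z]; elsewhere it
is the Stein equation. *)
Lemma stein_solution_le_derivE x : I x -> f1 x = h x - m - psi x * f x.
Proof.
move=> Ix; rewrite /stein_solution_le_deriv; case: eqVneq => [->|xz].
  by rewrite indic_rayE lexx.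
by have [_ ->] := stein_equation hD indic_ray_integrable Ix (indic_ray_continuous xz).
Qed.

Lemma stein_solution_le_slope x : I x -> x != z ->
  slope f x y @[y --> within I x^'] --> f1 x.
Proof.
move=> Ix xz; rewrite stein_solution_le_derivE//.
exact: (stein_solution_slope hD indic_ray_integrable Ix (indic_ray_continuous xz)).
Qed.

Lemma stein_solution_le_continuous : {within I, continuous f}.
Proof.
apply/subspace_continuousP => x Ix.
apply: (stein_solution_continuous hD indic_ray_integrable Ix ltr01 (c := 1)).
by move=> t _ _; exact: indic_ray_le1.
Qed.

Lemma stein_solution_le_measurable : measurable_fun I f.
Proof. exact: (subspace_continuous_measurable_fun mI stein_solution_le_continuous). Qed.

Lemma score_solution_continuous : {within I, continuous (fun x => psi x * f x)}.
Proof.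
apply/subspace_continuousP => x Ix; apply: cvgM.
  by move/subspace_continuousP : (score_continuous hD); exact.
by move/subspace_continuousP : stein_solution_le_continuous; exact.
Qed.

Lemma stein_solution_le_deriv_measurable : measurable_fun I f1.
Proof.
apply: (eq_measurable_fun (fun x => h x - m - psi x * f x)).
  by move=> x /set_mem Ix; rewrite stein_solution_le_derivE.
apply: measurable_funB.
  by apply: measurable_funB => //; exact: measurable_indic.
exact: (subspace_continuous_measurable_fun mI score_solution_continuous).
Qed.

Lemma score_solution_lipschitz x y : I x -> I y ->
  `|psi y * f y - psi x * f x| <= d4 * `|y - x|.
Proof.
have [_ _ _ dG] := hB z.
apply: (lipschitz_of_deriv hI (f' := deriv_in I (fun x => psi x * f x)) (z := z)
  score_solution_continuous) => t It tz.
  by apply: deriv_inP; have [] := dG t It tz.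
by have [] := dG t It tz.
Qed.

Lemma min_dist x y : `|Num.min x z - Num.min y z| <= `|x - y|.
Proof.
wlog xy : x y / y <= x => [H|].
  by have [/H//|/ltW/H] := leP y x; rewrite distrC (distrC y).
rewrite (@ger0_norm _ (x - y)) ?subr_ge0// ler_norml.
by case: (leP x z) => ?; case: (leP y z) => ?; apply/andP; split; lra.
Qed.

Lemma slope_min x : x != z ->
  slope (fun t => Num.min t z) x y @[y --> within I x^'] --> h x.
Proof.
move=> /near_ne[d d0 H]; apply/slope_cvgP => e e0.
exists d => // y Iy /H[_]; rewrite indic_rayE.
case: (leP x z) => xz yz.
  by rewrite !min_l ?yz// mul1r subrr normr0 mulr_ge0// ltW.
rewrite !min_r ?(ltW xz)//; last by rewrite ltW// ltNge yz.
by rewrite mul0r subrr subr0 normr0 mulr_ge0// ltW.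
Qed.

(** The oscillation of [f1] is at most [d3], so [f t - f1 x * t] is
[d3]-Lipschitz. *)
Lemma stein_solution_le_increment x y : I x -> I y ->
  `|(x - y) ^+ 2 * f1 x - (x - y) * (f x - f y)| <= d3 * (x - y) ^+ 2.
Proof.
move=> Ix Iy; have [_ _ df1 _] := hB z.
have : `|(f y - f1 x * y) - (f x - f1 x * x)| <= d3 * `|y - x|.
  apply: (lipschitz_of_deriv hI (f := fun t => f t - f1 x * t)
    (f' := fun t => f1 t - f1 x) (z := z)) => //.
  - apply/subspace_continuousP => t It; apply: cvgB.
      by move/subspace_continuousP : stein_solution_le_continuous; exact.
    by apply: cvgM; [exact: cvg_cst|exact: cvg_within].
  - move=> t It tz; apply: cvg_slopeB; first exact: stein_solution_le_slope.
    by rewrite -[X in _ --> X]mulr1; apply: cvg_slopeZ; exact: cvg_slope_id.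
  - by move=> t It _; exact: df1.
move=> H; have -> : (x - y) ^+ 2 * f1 x - (x - y) * (f x - f y) =
  (x - y) * ((f y - f1 x * y) - (f x - f1 x * x)) by ring.
rewrite normrM -(@real_normK _ (x - y)) ?num_real// expr2 mulrA mulrC.
by rewrite ler_wpM2r// (distrC x).
Qed.

(** Subtracting [min(t, z)] from [f t] removes the jump of the derivative at
[z]: what remains is [F] with derivative [- m - psi f], Lipschitz of constant
[d4].  The subtracted terms are the remainder of [min(., z)]. *)
Lemma stein_solution_le_taylor x y : I x -> I y ->
  `|(x - y) ^+ 2 * f1 x - (x - y) * (f x - f y)
    - ((x - y) ^+ 2 * h x - (x - y) * (Num.min x z - Num.min y z))|
  <= d4 / 2 * `|x - y| ^+ 3.
Proof.
move=> Ix Iy; pose F t := f t - Num.min t z; pose F1 t := - m - psi t * f t.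
have : `|F y - F x - F1 x * (y - x)| <= d4 / 2 * (y - x) ^+ 2.
  apply: (taylor_of_lipschitz_deriv hI (z := z)) => //.
  - apply/subspace_continuousP => t It; apply: cvgB.
      by move/subspace_continuousP : stein_solution_le_continuous; exact.
    apply/cvgrPdist_le => /= e e0; apply/nbhs_ballP; exists e => //= u.
    by move=> /ltW tu _; exact: le_trans (min_dist _ _) tu.
  - move=> t It tz; have -> : F1 t = f1 t - h t.
      by rewrite /F1 stein_solution_le_derivE//; ring.
    by apply: cvg_slopeB; [exact: stein_solution_le_slope|exact: slope_min].
  - move=> s t Is It; have -> : F1 t - F1 s = - (psi t * f t - psi s * f s).
      by rewrite /F1; ring.
    by rewrite normrN; exact: score_solution_lipschitz.
move=> H; rewrite stein_solution_le_derivE//.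
set k := (X in `|X|).
have -> : k = (x - y) * (F y - F x - F1 x * (y - x)) by rewrite /k /F /F1; ring.
rewrite normrM exprS mulrCA ler_wpM2l// real_normK ?num_real//.
by rewrite (_ : (x - y) ^+ 2 = (y - x) ^+ 2)//; ring.
Qed.

(** The remainder of [min(., z)] vanishes unless [z] separates [x] and [y], in
which case it equals [(x - y) (z - y)] up to sign; its sign depends on the side
of [z] on which [x] lies. *)
Lemma min_increment_bounds (A x y : R) : `|x - y| <= A ->
  - ((x - y) ^+ 2 * (z <= x <= z + A)%R%:R)
  <= (x - y) ^+ 2 * h x - (x - y) * (Num.min x z - Num.min y z)
  <= (x - y) ^+ 2 * (z - A <= x <= z - A + A)%R%:R.
Proof.
have sq (u : bool) : 0 <= (x - y) ^+ 2 * u%:R by rewrite mulr_ge0// sqr_ge0.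
rewrite ler_norml => /andP[xyA1 xyA2]; rewrite indic_rayE subrK.
case: (leP x z) => xz.
  have [yz|/ltW zy] := leP y z.
    rewrite /= mulr1 -expr2 subrr sq andbT oppr_le0; exact: sq.
  rewrite mulr1 (_ : z - A <= x); last lra.
  apply/andP; split; last by rewrite mulr1; nra.
  by apply: (@le_trans _ _ 0); [rewrite oppr_le0; exact: sq|nra].
have [yz|/ltW zy] := leP y z; last first.
  by rewrite mulr0 subrr mulr0 subrr sq oppr_le0 sq.
rewrite (_ : x <= z + A); last lra.
rewrite (ltW xz) /= mulr1 mulr0 sub0r; apply/andP; split; first nra.
by apply: (@le_trans _ _ 0); [nra|exact: sq].
Qed.

(** The upper and the lower bound involve different intervals of length [A], one
on each side of [z].  Since only one of them enters each inequality, the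
expectation of a single such term has to be estimated. *)
Lemma kolmogorov_pointwise (A x y : R) : 0 < A -> I x -> I y ->
  let e := d3 * ((x - y) ^+ 2 * (A <= `|x - y|)%R%:R) + d4 / 2 * A ^+ 3 in
  let k := (x - y) ^+ 2 * f1 x - (x - y) * (f x - f y) in
  - (e + (x - y) ^+ 2 * ((`|x - y| <= A) && (z <= x <= z + A))%R%:R) <= k
  <= e + (x - y) ^+ 2 * ((`|x - y| <= A) && (z - A <= x <= z - A + A))%R%:R.
Proof.
move=> A0 Ix Iy /=.
have sq (u : bool) : 0 <= (x - y) ^+ 2 * u%:R by rewrite mulr_ge0// sqr_ge0.
have d40 : 0 <= d4.
  have [_ _ _ dG] := hB z; have [xz|xz] := eqVneq x z; last first.
    by have [_] := dG x Ix xz; apply: le_trans.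
  have [u Iu ux] := interval_other hI Ix; rewrite xz in ux.
  by have [_] := dG u Iu ux; apply: le_trans.
have d4A : 0 <= d4 / 2 * A ^+ 3 by rewrite mulr_ge0 ?divr_ge0 ?exprn_ge0// ltW.
have [Axy|xyA] := leP A `|x - y|.
  have := stein_solution_le_increment Ix Iy; rewrite ler_norml mulr1 => /andP[k1 k2].
  have := sq ((`|x - y| <= A) && (z <= x <= z + A)).
  have := sq ((`|x - y| <= A) && (z - A <= x <= z - A + A)).
  by move=> *; apply/andP; split; lra.
have := min_increment_bounds (ltW xyA); rewrite (ltW xyA) /= => /andP[k1 k2].
have := stein_solution_le_taylor Ix Iy.
have : d4 / 2 * `|x - y| ^+ 3 <= d4 / 2 * A ^+ 3.
  by rewrite ler_wpM2l ?divr_ge0// lerXn2r ?nnegrE// ltW.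
rewrite mulr0 mulr0 add0r ler_norml => ? /andP[? ?].
by apply/andP; split; lra.
Qed.
End kolmogorov_pointwise.

(** * Lipschitz test functions *)

Lemma deriv_norm_ge0 (R : realType) (I : set R) (h : R -> R) (x : R) :
  I x -> derivable_in I h x -> (0 <= deriv_norm I h)%E.
Proof.
move=> Ix dx; apply: (@le_trans _ _ `|deriv_in I h x|%:E); first by rewrite lee_fin.
by apply: ereal_sup_ubound; exists x.
Qed.

Lemma sup_norm_le (R : realType) (I : set R) (f : R -> R) (c x : R) :
  (sup_norm I f <= c%:E)%E -> I x -> `|f x| <= c.
Proof.
move=> fc Ix; rewrite -lee_fin; apply: le_trans fc.
by apply: ereal_sup_ubound; exists x.
Qed.

Section lipschitz.
Context (R : realType) (a b : \bar R) (I : set R).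
Hypothesis hI : interval_with_endpoints a b I.
Variables (h : R -> R) (k : R).
Hypothesis hk : forall x y, I x -> I y -> `|h x - h y| <= k * `|x - y|.

Lemma lipschitz_abs_continuous : abs_continuous_in I h.
Proof.
move=> u v Iu Iv e e0; have k1 : 0 < `|k| + 1 by rewrite ltr_wpDl.
exists (e / (`|k| + 1)); first by rewrite divr_gt0.
move=> n s t st _ sum.
have step : \sum_(i < n) `|h (t i) - h (s i)| <= (`|k| + 1) * \sum_(i < n) (t i - s i).
  rewrite mulr_sumr; apply: ler_sum => i _; have [us [sti tv]] := st i.
  have Is : I (s i) by apply: (interval_conv hI Iu Iv) => //; exact: le_trans sti tv.
  have It : I (t i) by apply: (interval_conv hI Iu Iv) => //; exact: le_trans us sti.
  rewrite (le_trans (hk It Is))// (@ger0_norm _ (t i - s i)) ?subr_ge0//.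
  rewrite ler_wpM2r ?subr_ge0//; have := ler_norm k; lra.
by rewrite (le_lt_trans step)// mulrC -ltr_pdivlMr.
Qed.

Lemma lipschitz_continuous_in : {within I, continuous h}.
Proof.
apply/subspace_continuousP => x Ix; apply/cvgrPdist_le => /= e e0.
have k1 : 0 < `|k| + 1 by rewrite ltr_wpDl.
apply/nbhs_ballP; exists (e / (`|k| + 1)) => /=; first by rewrite divr_gt0.
move=> y; rewrite /ball/= ltr_pdivlMr// => xy Iy.
rewrite (le_trans (hk Ix Iy))//; have := ler_norm k.
have := normr_ge0 (x - y); nra.
Qed.

Lemma lipschitz_deriv_norm : (deriv_norm I h <= k%:E)%E.
Proof.
apply: ge_ereal_sup => _ [x [Ix dx] <-]; rewrite lee_fin.
have pf := interval_dnbhs_proper hI Ix.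
have H : `|slope h x y| @[y --> within I x^'] --> `|deriv_in I h x|.
  by apply: cvg_norm; exact: deriv_inP.
apply: (cvgr_to_le H); apply/nbhs_ballP; exists 1 => //= y _ yx Iy.
rewrite /slope normrM normfV ler_pdivrMr ?hk//.
by rewrite normr_gt0 subr_eq0.
Qed.
End lipschitz.

(** Truncations of [x - x0] are bounded, hence integrable against [p], and have
derivative 1 at [x0].  They bring out what [assumption_B1] entails beyond its
wording. *)
Section test_functions.
Context (R : realType) (a b : \bar R) (I : set R) (p : R -> R).
Variables (c1 c2 c3 : R).
Hypotheses (hD : assumption_D a b I p) (hB : assumption_B1 I p c1 c2 c3).
Local Notation mu := (@lebesgue_measure R).
Implicit Types (h : R -> R) (x y : R).

Let hI : interval_with_endpoints a b I. Proof. by case: hD. Qed.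
Let mI : measurable I := interval_measurable hI.

Variable x0 : R.
Hypothesis Ix0 : I x0.

(** The truncation level is at least 1, so that the function is [x - x0] near
[x0] for every [n]. *)
Definition test_function (n : nat) x := clamp n.+1%:R (x - x0).

Lemma test_function_lipschitz n x y :
  `|test_function n x - test_function n y| <= 1 * `|x - y|.
Proof.
rewrite mul1r (le_trans (clamp_dist _ _ _))// opprB addrA subrK.
exact: lexx.
Qed.

Lemma test_function_integrable n : integrable_against I p (test_function n).
Proof.
apply: (integrable_against_bounded hD (c := n.+1%:R)); last by move=> x _; exact: clamp_le.
apply: measurable_funTS; apply: measurableT_comp; first exact: measurable_clamp.
exact: measurable_funB.
Qed.

Lemma test_function_derivable n : derivable_in I (test_function n) x0.
Proof.
suff /(deriv_inE hI Ix0)[] :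
  slope (test_function n) x0 y @[y --> within I x0^'] --> (1 : R) by [].
apply/slope_cvgP => e e0.
exists 1 => // y Iy y1; rewrite /test_function !clamp_id.
- by rewrite mul1r subrr subr0 subrr normr0 mulr_ge0// ltW.
- by rewrite subrr normr0.
- by rewrite (le_trans (ltW y1))// ler1n.
Qed.

Lemma test_function_deriv_norm n : (0 <= deriv_norm I (test_function n) <= 1)%E.
Proof.
rewrite (deriv_norm_ge0 Ix0 (@test_function_derivable n)) /=.
exact: (lipschitz_deriv_norm hI (fun x y _ _ => test_function_lipschitz n x y)).
Qed.

Lemma test_function_sup_norm n :
  (sup_norm I (stein_solution I p (test_function n)) <=
   c1%:E * deriv_norm I (test_function n))%E.
Proof.
have /andP[_ dn1] := test_function_deriv_norm n.
have [] := @hB (test_function n) _ (test_function_integrable n) _ => //.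
  exact: (lipschitz_abs_continuous hI (fun x y _ _ => test_function_lipschitz n x y)).
by rewrite (le_lt_trans dn1)// ltry.
Qed.

(** Otherwise the solution of the Stein equation for a truncation would vanish,
and the truncation would be constant by the Stein equation. *)
Lemma B1_c1_gt0 : 0 < c1.
Proof.
rewrite ltNge; apply/negP => c10; have /andP[dn0 _] := test_function_deriv_norm 0.
have f0 x : I x -> stein_solution I p (test_function 0) x = 0.
  move=> Ix; apply/eqP; rewrite -normr_le0.
  apply: sup_norm_le Ix; apply: (le_trans (test_function_sup_norm 0)).
  by rewrite mule_le0_ge0// lee_fin.
have hm x : I x -> test_function 0 x = density_mean I p (test_function 0).
  move=> Ix; have ch : test_function 0 y @[y --> within I (nbhs x)] --> test_function 0 x.
    have /subspace_continuousP := lipschitz_continuous_in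
      (fun x y (_ : I x) (_ : I y) => test_function_lipschitz 0 x y).
    exact.
  have s1 := stein_solution_slope hD (test_function_integrable 0) Ix ch.
  have s0 : slope (stein_solution I p (test_function 0)) x y @[y --> within I x^'] --> (0 : R).
    apply: cvg_near_cst; apply/nbhs_ballP; exists 1 => //= y _ _ Iy.
    by rewrite /slope !f0// subrr mul0r.
  have pf := interval_dnbhs_proper hI Ix.
  have : 0 = test_function 0 x - density_mean I p (test_function 0)
             - score I p x * stein_solution I p (test_function 0) x.
    exact: cvg_unique s0 s1.
  by rewrite f0// mulr0 subr0 => /esym/subr0_eq.
have [y [Iy yx y1]] := interval_near hI Ix0 ltr01.
have := hm y Iy; rewrite -(hm x0 Ix0) /test_function subrr !clamp_id ?normr0//.
  by move/eqP; rewrite subr_eq0 (negbTE yx).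
exact: ltW.
Qed.

(** A Lipschitz function without any point of differentiability would have
[deriv_norm] equal to [-oo]; since [c1] is positive, [assumption_B1] would then
bound a [sup_norm] by [-oo]. *)
Lemma B1_deriv_norm h (k : R) : integrable_against I p h ->
  (forall x y, I x -> I y -> `|h x - h y| <= k * `|x - y|) ->
  exists2 K : R, 0 <= K & deriv_norm I h = K%:E.
Proof.
move=> ih hk; have dnk := lipschitz_deriv_norm hI hk.
have dnoo : (deriv_norm I h < +oo)%E by rewrite (le_lt_trans dnk)// ltry.
have dn0 : (0 <= deriv_norm I h)%E.
  have [[x [Ix dx]]|no] := pselect (exists x, I x /\ derivable_in I h x).
    exact: deriv_norm_ge0 Ix dx.
  have dn : deriv_norm I h = -oo%E.
    rewrite /deriv_norm (_ : [set _ | _ in _] = set0) ?ereal_sup0//.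
    by apply/seteqP; split => // t [x [Ix dx] _]; apply: no; exists x.
  have : (sup_norm I (stein_solution I p h) <= c1%:E * deriv_norm I h)%E.
    by have [] := hB (lipschitz_abs_continuous hI hk) ih dnoo.
  rewrite dn gt0_muleNy ?lte_fin ?B1_c1_gt0// leeNy_eq => /eqP supE.
  have : (`|stein_solution I p h x0|%:E <= sup_norm I (stein_solution I p h))%E.
    by apply: ereal_sup_ubound; exists x0.
  by rewrite supE.
exists (fine (deriv_norm I h)); first exact: fine_ge0.
by rewrite fineK// ge0_fin_numE.
Qed.

End test_functions.

Section first_moment.
Context (R : realType) (a b : \bar R) (I : set R) (p : R -> R).
Variables (c1 c2 c3 : R).
Hypotheses (hD : assumption_D a b I p) (hB : assumption_B1 I p c1 c2 c3).
Local Notation mu := (@lebesgue_measure R).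
Implicit Types (h : R -> R) (x y : R).

Let hI : interval_with_endpoints a b I. Proof. by case: hD. Qed.
Let mI : measurable I := interval_measurable hI.

Lemma primitive_density_increasing x y : I x -> I y -> x < y ->
  primitive_in I p x < primitive_in I p y.
Proof.
move=> Ix Iy xy; have sl t : I t -> slope (primitive_in I p) t s @[s --> within I t^'] --> p t.
  move=> It; apply: (primitive_in_slope hI (density_integrable hD) It).
  by move/subspace_continuousP : (density_continuous hD); exact.
have [t /andP[xt ty] E] := mvt_in hI Ix Iy xy sl.
have It : I t by apply: (interval_conv hI Ix Iy); exact: ltW.
by rewrite -subr_gt0 E mulr_gt0 ?subr_gt0// (density_gt0 hD).
Qed.

Lemma primitive_density_bounds x : I x -> 0 <= primitive_in I p x <= 1.
Proof.
move=> Ix; have [_ [[[mp p0 p1] _ _] _]] := hD; apply/andP; split.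
  by apply: Rintegral_ge0 => t [It _]; exact: p0.
rewrite -lee_fin -p1 /primitive_in /Rintegral fineK; last first.
  have mL : measurable (I `&` `]-oo, x]) by exact: measurableI.
  have LI : I `&` `]-oo, x] `<=` I by move=> t [].
  apply: integrable_fin_num; first exact: mL.
  exact: (@integrableS _ _ _ mu I _ _ mI mL LI (density_integrable hD)).
apply: (@ge0_subset_integral _ _ _ mu _ I _ mI) => //; first exact: measurableI.
by exact/measurable_EFinP.
Qed.

(** With [al] the mass to the left of [x0], and [N <= 0 <= M] the contributions of
the two sides of [x0] to the mean of the truncation [h], the solution satisfies
[p(x0) f_h(x0) = N - (N + M) al = (1 - al) N - al M].  Both terms have the same
sign, so a bound on [f_h(x0)] bounds [M - N], the integral of [|h| p].  The bound
[c1] does not depend on the level of truncation. *)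
Lemma B1_test_function_moment : exists x0 (B : R), I x0 /\ forall n,
  \int[mu]_(x in I) (`|test_function x0 n x| * p x) <= B.
Proof.
have [u [x0 [v [Iu Ix0 Iv /andP[ux0 x0v]]]]] := interval_three_points hI.
pose al := primitive_in I p x0.
have al0 : 0 < al.
  apply: le_lt_trans (primitive_density_increasing Iu Ix0 ux0).
  by have /andP[] := primitive_density_bounds Iu.
have al1 : al < 1.
  apply: lt_le_trans (primitive_density_increasing Ix0 Iv x0v) _.
  by have /andP[] := primitive_density_bounds Iv.
pose be := Num.min al (1 - al).
have be0 : 0 < be by rewrite lt_min al0 subr_gt0.
have be1 : be <= al by rewrite ge_min lexx.
have be2 : be <= 1 - al by rewrite ge_min lexx orbT.
exists x0, (c1 * p x0 / be); split=> // n; set h := test_function x0 n.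
have px0 := density_gt0 hD Ix0.
have ih : integrable_against I p h by exact: (test_function_integrable hD).
have [mh ihp] := ih; have /integrableP[/measurable_EFinP mp _] := density_integrable hD.
pose L := I `&` `]-oo, x0].
have mL : measurable L by exact: measurableI.
have LI : L `<=` I by move=> t [].
have iS g : mu.-integrable I (EFin \o g) -> mu.-integrable L (EFin \o g).
  by move=> ig; exact: (@integrableS _ _ _ mu I L _ mI mL LI ig).
have ihp' : mu.-integrable I (EFin \o (fun x => h x * p x)) by [].
have iabs : mu.-integrable I (EFin \o (fun x => `|h x| * p x)).
  apply: (@le_integrable _ _ _ mu _ mI _ (EFin \o (fun x => h x * p x))) ihp'.
    apply/measurable_EFinP; apply: measurable_funM; last exact: mp.
    exact: measurableT_comp.
  by move=> t It; rewrite /= lee_fin !normrM normr_id.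
set m := density_mean I p h.
pose N := \int[mu]_(x in L) (h x * p x).
pose Tot := \int[mu]_(x in I) (`|h x| * p x).
have fE : p x0 * stein_solution I p h x0 = N - m * al.
  rewrite /stein_solution mulVKf ?gt_eqF// -/m.
  rewrite -(@RintegralZl _ _ _ mu L p m mL (iS _ (density_integrable hD))) -RintegralB//.
  - by apply: eq_Rintegral => t _; rewrite mulrBl.
  - exact: iS.
  - apply: (iS (fun t => m * p t)).
    exact: (@integrableZl _ _ _ mu _ mI _ _ (density_integrable hD)).
have fb : `|N - m * al| <= c1 * p x0.
  rewrite -fE normrM (gtr0_norm px0) mulrC ler_wpM2r ?(ltW px0)//.
  apply: (sup_norm_le _ Ix0).
  apply: (le_trans (test_function_sup_norm hD hB Ix0 n)).
  have /andP[dn0 dn1] := test_function_deriv_norm hD Ix0 n.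
  rewrite -[leRHS]mule1 lee_wpmul2l// lee_fin ltW//.
  exact: (B1_c1_gt0 hD hB Ix0).
pose U := I `\` L.
have mU : measurable U by exact: measurableD.
have split g : mu.-integrable I (EFin \o g) ->
    \int[mu]_(x in I) g x = \int[mu]_(x in L) g x + \int[mu]_(x in U) g x.
  move=> ig; rewrite -Rintegral_setU//; first by rewrite /U setDUK.
    by rewrite /U setDUK.
  by apply/disj_setPS => t [Lt [_ /(_ Lt)]].
pose M := \int[mu]_(x in U) (h x * p x).
have hL t : L t -> h t <= 0.
  move=> [_]; rewrite /= in_itv /= => tx; apply: clamp_le0 => //.
  by rewrite subr_le0.
have hU t : U t -> 0 <= h t.
  move=> [It]; rewrite /L /= in_itv /= => /not_andP[//|/negP]; rewrite -ltNge => tx.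
  by apply: clamp_ge0 => //; rewrite subr_ge0 ltW.
have mE : m = N + M by exact: (split (fun x => h x * p x)).
have TotE : Tot = - N + M.
  rewrite /Tot (split (fun x => `|h x| * p x) iabs); congr (_ + _).
    rewrite -mulN1r -(@RintegralZl _ _ _ mu L (fun x => h x * p x) (-1) mL (iS _ ihp')).
    by apply: eq_Rintegral => t /set_mem/hL h0; rewrite ler0_norm//; ring.
  by apply: eq_Rintegral => t /set_mem/hU h0; rewrite ger0_norm.
have N0 : N <= 0.
  rewrite -oppr_ge0 -mulN1r.
  rewrite -(@RintegralZl _ _ _ mu L (fun x => h x * p x) (-1) mL (iS _ ihp')).
  apply: Rintegral_ge0 => t Lt.
  rewrite mulN1r oppr_ge0 mulr_le0_ge0 ?hL// ltW//.
  by apply: (density_gt0 hD); exact: LI.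
have M0 : 0 <= M.
  apply: Rintegral_ge0 => t Ut; rewrite mulr_ge0 ?hU// ltW//.
  by apply: (density_gt0 hD); case: Ut.
rewrite -/Tot ler_pdivlMr//.
move: fb; rewrite ler_norml => /andP[fb1 _].
rewrite mE in fb1.
rewrite TotE; nra.
Qed.

Lemma B1_first_moment : exists2 x0 : R, I x0 &
  mu.-integrable I (fun x => (`|x - x0| * p x)%:E).
Proof.
have [x0 [B [Ix0 HB]]] := B1_test_function_moment; exists x0 => //.
have [_ [[[mp p0 _] _ _] _]] := hD.
have mx : measurable_fun I (fun x => `|x - x0|).
  by apply: measurable_funTS; apply: measurableT_comp => //; exact: measurable_funB.
have mt n : measurable_fun I (fun x => `|test_function x0 n x| * p x).
  apply: measurable_funM => //; apply: measurableT_comp => //.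
  by have [] := test_function_integrable hD x0 n.
have cvgI : (\int[mu]_(x in I) (`|test_function x0 n x| * p x)%:E @[n --> \oo] -->
    \int[mu]_(x in I) (`|x - x0| * p x)%:E)%E.
  have -> : (\int[mu]_(x in I) (`|x - x0| * p x)%:E =
      \int[mu]_(x in I) limn (fun n => (`|test_function x0 n x| * p x)%:E))%E.
    apply: eq_integral => x xI; apply/esym/cvg_lim => //.
    apply: cvg_EFin; first exact: nearW.
    apply: cvgM; last exact: cvg_cst.
    apply: cvg_norm.
    rewrite (_ : test_function x0 ^~ x = fun n => clamp (n + 1)%:R (x - x0)); last first.
      by apply/funext => n; rewrite addn1.
    have := @clamp_cvg R (x - x0); rewrite -(cvg_shiftn 1).
    exact.
  apply: (@cvg_monotone_convergence _ _ _ mu I mI) => //.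
  - by move=> n; apply/measurable_EFinP; exact: mt.
  - by move=> n x Ix; rewrite lee_fin mulr_ge0// p0.
  - move=> x Ix n m nm; rewrite lee_fin ler_wpM2r ?p0//.
    by apply: clamp_norm_nd => //; rewrite ler_nat.
apply/integrableP; split; first by apply/measurable_EFinP; exact: measurable_funM.
rewrite (_ : (\int[mu]_(x in I) _)%E = (\int[mu]_(x in I) (`|x - x0| * p x)%:E)%E); last first.
  apply: eq_integral => x /set_mem Ix /=.
  by rewrite ger0_norm// mulr_ge0// p0.
apply: (@le_lt_trans _ _ B%:E); last exact: ltry.
rewrite -(cvg_lim _ cvgI)//; apply: lime_le; first by apply/cvg_ex; eexists; exact: cvgI.
apply: nearW => n; rewrite -[leLHS]fineK ?lee_fin; first exact: HB.
have [_ it] := test_function_integrable hD x0 n.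
apply: integrable_fin_num => //.
apply: (@le_integrable _ _ _ mu _ mI _ _ _ _ it).
  by apply/measurable_EFinP; exact: mt.
by move=> x Ix; rewrite !abse_EFin lee_fin !normrM normr_id.
Qed.

Lemma B1_lipschitz_integrable h (k : R) :
  (forall x y, I x -> I y -> `|h x - h y| <= k * `|x - y|) -> integrable_against I p h.
Proof.
move=> hk; have [x0 Ix0 ix] := B1_first_moment.
have mh : measurable_fun I h.
  exact: (subspace_continuous_measurable_fun mI (lipschitz_continuous_in hk)).
have [_ [[[mp p0 _] _ _] _]] := hD.
split => //.
apply: (@le_integrable _ _ _ mu _ mI _
  (fun x => `|h x0|%:E * (p x)%:E + `|k|%:E * (`|x - x0| * p x)%:E)%E).
- by apply/measurable_EFinP; exact: measurable_funM.
- move=> x Ix; rewrite -!EFinM -EFinD !abse_EFin lee_fin mulrA -mulrDl !normrM.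
  rewrite ler_wpM2r// [leRHS]ger0_norm ?addr_ge0 ?mulr_ge0//.
  rewrite -lerBlDl (le_trans (lerB_dist _ _))// (le_trans (hk _ _ Ix Ix0))//.
  by rewrite ler_wpM2r// ler_norm.
- apply: integrableD => //.
    exact: (@integrableZl _ _ _ mu _ mI _ _ (density_integrable hD)).
  exact: (@integrableZl _ _ _ mu _ mI _ _ ix).
Qed.

End first_moment.

(** * Bounds on the distance between W and Z *)

Section stein_bounds.
Context (R : realType) (a b : \bar R) (I : set R) (p : R -> R).
Context d (T : measurableType d) (P : probability T R).
Variables (W W' : {RV P >-> R}) (r : R -> R) (lambda : R) (V : T -> R).
Hypotheses (hD : assumption_D a b I p).
Hypotheses (hWI : forall w, I (W w)) (hW'I : forall w, I (W' w)).
Hypothesis exch : exchangeable_pair P W W'.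
Hypothesis hlambda : 0 < lambda.
Hypothesis hreg : is_cond_expectation P W W'
  (fun w => W w + lambda * score I p (W w) - r (W w)).
Hypothesis hV : is_cond_expectation P W (fun w => (W w - W' w) ^+ 2) V.

Local Notation psi := (score I p).
Local Notation integrableR X := (P.-integrable setT (fun w => (X w)%:E)).
Local Notation E X := (Rintegral P setT X).
Local Notation S := (fun w => lambda * psi (W w) - r (W w)).

Let hI : interval_with_endpoints a b I. Proof. by case: hD. Qed.
Let mI : measurable I := interval_measurable hI.
Let mW : measurable_fun setT W. Proof. by []. Qed.
Let mW' : measurable_fun setT W'. Proof. by []. Qed.

Let reg : is_cond_expectation P W W' (fun w => W w + S w).
Proof.
by have -> : (fun w => W w + S w) = (fun w => W w + lambda * psi (W w) - r (W w))
  by apply/funext => w; rewrite addrA.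
Qed.

Let iD2 : integrableR (fun w => (W w - W' w) ^+ 2).
Proof. by case: hV. Qed.

Let iV : integrableR V.
Proof. by case: hV. Qed.

Let iD : integrableR (fun w => W w - W' w).
Proof.
apply: integrableRB; first exact: (exchangeable_integrable mW mW' exch reg).
by case: hreg.
Qed.

Let patchW (f : R -> R) (X : T -> R) : (forall w, I (X w)) ->
  (fun w => (f \_ I) (X w)) = (fun w => f (X w)).
Proof. by move=> XI; apply/funext => w; rewrite patchE mem_set. Qed.

Let measurable_in (f : R -> R) (X : T -> R) : measurable_fun setT X ->
  (forall w, I (X w)) -> measurable_fun I f -> measurable_fun setT (fun w => f (X w)).
Proof.
move=> mX XI mf; rewrite -(patchW f XI).
by apply: measurableT_comp mX; apply/(measurable_restrictT _ mI).
Qed.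

Let patch_bounded (f : R -> R) (c : R) : (forall x, I x -> `|f x| <= c) ->
  forall x, `|(f \_ I) x| <= `|c|.
Proof.
move=> fc x; rewrite patchE; case: ifPn => [/set_mem/fc fx|_].
  exact: le_trans fx (ler_norm _).
by rewrite /point/= normr0.
Qed.

Lemma stein_identity_in (f : R -> R) (c : R) : measurable_fun I f ->
  (forall x, I x -> `|f x| <= c) ->
  E (fun w => (W w - W' w) * (f (W w) - f (W' w))) = - 2 * E (fun w => f (W w) * S w).
Proof.
move=> mf fc.
have mfI : measurable_fun setT (f \_ I) by apply/(measurable_restrictT _ mI).
have := stein_identity mW mW' exch reg mfI (patch_bounded fc).
under eq_Rintegral do rewrite !patchE !mem_set//.
by under [X in _ = _ * X -> _]eq_Rintegral do rewrite !patchE !mem_set//.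
Qed.

Lemma pull_out_in (f : R -> R) (c : R) : measurable_fun I f ->
  (forall x, I x -> `|f x| <= c) ->
  E (fun w => f (W w) * (W w - W' w) ^+ 2) = E (fun w => f (W w) * V w).
Proof.
move=> mf fc.
have mfI : measurable_fun setT (f \_ I) by apply/(measurable_restrictT _ mI).
have := cond_expectation_pull_out mW hV mfI (patch_bounded fc).
under eq_Rintegral do rewrite !patchE !mem_set//.
by under [X in _ = X -> _]eq_Rintegral do rewrite !patchE !mem_set//.
Qed.

Hypothesis ir : integrableR (fun w => r (W w)).

Lemma score_integrable : integrableR (fun w => psi (W w)).
Proof.
have iS := regression_integrable mW mW' exch reg.
have -> : (fun w => (psi (W w))%:E) = (fun w => (lambda^-1 * (S w + r (W w)))%:E).
  by apply/funext => w; rewrite subrK mulKf// gt_eqF.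
by apply: integrableRZ; exact: integrableRD.
Qed.

(** [f1] stands for the derivative of [f], but the identity is formal: it holds
for any pair of bounded functions. *)
Lemma stein_decomposition (f f1 : R -> R) (c c1 : R) :
  measurable_fun I f -> (forall x, I x -> `|f x| <= c) ->
  measurable_fun I f1 -> (forall x, I x -> `|f1 x| <= c1) ->
  E (fun w => f1 (W w) + psi (W w) * f (W w)) =
  E (fun w => f1 (W w) * (1 - (2 * lambda)^-1 * V w))
  + (2 * lambda)^-1 * E (fun w => (W w - W' w) ^+ 2 * f1 (W w)
                          - (W w - W' w) * (f (W w) - f (W' w)))
  + lambda^-1 * E (fun w => f (W w) * r (W w)).
Proof.
move=> mf fc mf1 f1c; have ipsi := score_integrable.
have mfW := measurable_in mW hWI mf; have mf1W := measurable_in mW hWI mf1.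
have mfW' := measurable_in mW' hW'I mf.
have fcW w : `|f (W w)| <= c by exact: fc.
have f1cW w : `|f1 (W w)| <= c1 by exact: f1c.
have if1 : integrableR (fun w => f1 (W w)) by exact: (integrableR_bounded P mf1W f1cW).
have if1V : integrableR (fun w => f1 (W w) * V w) by exact: (integrableRM mf1W f1cW).
have if1D : integrableR (fun w => f1 (W w) * (W w - W' w) ^+ 2).
  exact: (integrableRM mf1W f1cW).
have ifr : integrableR (fun w => f (W w) * r (W w)) by exact: (integrableRM mfW fcW).
have ifpsi : integrableR (fun w => f (W w) * psi (W w)) by exact: (integrableRM mfW fcW).
have iDf : integrableR (fun w => (f (W w) - f (W' w)) * (W w - W' w)).
  apply: (integrableRM (c := c + c)) => // [|w]; first exact: measurable_funB.
  by rewrite (le_trans (ler_normB _ _))// lerD// fc.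
have EN := stein_identity_in mf fc; have EV := pull_out_in mf1 f1c.
have -> : E (fun w => f1 (W w) + psi (W w) * f (W w)) =
    E (fun w => f1 (W w)) + E (fun w => f (W w) * psi (W w)).
  rewrite -RintegralD//.
  by apply: eq_Rintegral => w _; rewrite (mulrC (psi _)).
have -> : E (fun w => f1 (W w) * (1 - (2 * lambda)^-1 * V w)) =
    E (fun w => f1 (W w)) - (2 * lambda)^-1 * E (fun w => f1 (W w) * V w).
  rewrite -RintegralZl// -RintegralB//; last exact: integrableRZ.
  by apply: eq_Rintegral => w _; ring.
have -> : E (fun w => (W w - W' w) ^+ 2 * f1 (W w)
                          - (W w - W' w) * (f (W w) - f (W' w))) =
    E (fun w => f1 (W w) * (W w - W' w) ^+ 2) -
    E (fun w => (W w - W' w) * (f (W w) - f (W' w))).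
  rewrite -RintegralB//; first by apply: eq_Rintegral => w _; ring.
  by under eq_fun do rewrite mulrC.
rewrite EV EN.
have -> : E (fun w => f (W w) * (lambda * psi (W w) - r (W w))) =
    lambda * E (fun w => f (W w) * psi (W w)) - E (fun w => f (W w) * r (W w)).
  rewrite -RintegralZl// -RintegralB//; last exact: integrableRZ.
  by apply: eq_Rintegral => w _; ring.
by field; rewrite gt_eqF.
Qed.

(** The absolute value of the middle term stays outside the expectation, because
for indicators its positive and negative parts are estimated separately. *)
Lemma stein_bound (f f1 : R -> R) (c c1 : R) :
  measurable_fun I f -> (forall x, I x -> `|f x| <= c) ->
  measurable_fun I f1 -> (forall x, I x -> `|f1 x| <= c1) ->
  integrableR (fun w => r (W w) ^+ 2) ->
  `|E (fun w => f1 (W w) + psi (W w) * f (W w))| <=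
  c1 * E (fun w => `|1 - (2 * lambda)^-1 * V w|)
  + (2 * lambda)^-1 * `|E (fun w => (W w - W' w) ^+ 2 * f1 (W w)
                          - (W w - W' w) * (f (W w) - f (W' w)))|
  + c * (Num.sqrt (E (fun w => r (W w) ^+ 2)) / lambda).
Proof.
move=> mf fc mf1 f1c ir2; rewrite (stein_decomposition mf fc mf1 f1c).
have mfW := measurable_in mW hWI mf; have mf1W := measurable_in mW hWI mf1.
have iV1 : integrableR (fun w => 1 - (2 * lambda)^-1 * V w).
  by apply: integrableRB; [exact: integrableR_cst|exact: integrableRZ].
have [w0 _] := probability_inhabited P.
have c0 : 0 <= c by exact: le_trans (normr_ge0 _) (fc _ (hWI w0)).
rewrite (le_trans (ler_normD _ _))// lerD//.
  rewrite (le_trans (ler_normD _ _))// lerD//.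
    rewrite (le_trans (le_normr_Rintegral _ _))//.
      by apply: (integrableRM (c := c1)) => // w; exact: f1c.
    rewrite -RintegralZl//; last exact: integrableR_norm.
    apply: le_Rintegral => //.
    - by apply: integrableR_norm; apply: (integrableRM (c := c1)) => // w; exact: f1c.
    - by apply: integrableRZ; exact: integrableR_norm.
    - by move=> w _; rewrite normrM ler_wpM2r// f1c.
  by rewrite normrM gtr0_norm// invr_gt0 mulr_gt0.
rewrite normrM gtr0_norm ?invr_gt0// (mulrC lambda^-1) mulrA ler_wpM2r//.
  by rewrite invr_ge0 ltW.
apply: le_trans (_ : c * E (fun w => `|r (W w)|) <= _); last first.
  by rewrite ler_wpM2l// Rintegral_abs_le_sqrt.
rewrite (le_trans (le_normr_Rintegral _ _))//.
  by apply: (integrableRM (c := c)) => // w; exact: fc.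
rewrite -RintegralZl//; last exact: integrableR_norm.
apply: le_Rintegral => //.
- by apply: integrableR_norm; apply: (integrableRM (c := c)) => // w; exact: fc.
- by apply: integrableRZ; exact: integrableR_norm.
- by move=> w _; rewrite normrM ler_wpM2r// fc.
Qed.


(** Apply [stein_identity_in] to the nondecreasing [f] which has slope 1 on
[[u - A, u + 2 A]] and is constant outside.  The product
[(W - W') (f(W) - f(W'))] is nonnegative and equals [(W - W') ^+ 2] when [W] is
in [[u, u + A]] and [`|W - W'| <= A].  Centring [f] gives [`|f| <= 3 A / 2]. *)
Lemma concentration (A u : R) : 0 < A ->
  E (fun w => (W w - W' w) ^+ 2 *
    ((`|W w - W' w| <= A) && (u <= W w <= u + A))%R%:R) <=
  3 * A * (lambda * E (fun w => `|psi (W w)|) + E (fun w => `|r (W w)|)).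
Proof.
move=> A0; pose f x := clamp (3 / 2 * A) (x - u - A / 2).
have A32 : 0 <= 3 / 2 * A by rewrite mulr_ge0// ltW.
have mf : measurable_fun I f.
  apply: measurable_funTS; apply: measurableT_comp; first exact: measurable_clamp.
  by apply: measurable_funB => //; exact: measurable_funB.
have fc x : I x -> `|f x| <= 3 / 2 * A by move=> _; exact: clamp_le.
have ipsi := score_integrable.
have iS : integrableR S by exact: (regression_integrable mW mW' exch reg).
have mfW := measurable_in mW hWI mf.
have mfW' := measurable_in mW' hW'I mf.
have ifS : integrableR (fun w => f (W w) * S w).
  by apply: (integrableRM (c := 3 / 2 * A)) => // w; exact: fc.
apply: (@le_trans _ _ (E (fun w => (W w - W' w) * (f (W w) - f (W' w))))).
  apply: le_Rintegral => //.
  - apply: (integrableR_le _ iD2).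
      apply: measurable_funM; first exact: integrableR_measurable iD2.
      apply: measurable_natb; apply: measurable_and.
        apply: measurable_fun_ler => //; apply: measurableT_comp => //.
        exact: integrableR_measurable iD.
      by apply: measurable_and; apply: measurable_fun_ler.
    move=> w; rewrite normrM [X in _ * X]ger0_norm// ler_piMr//.
    by rewrite lern1 leq_b1.
  - under eq_fun do rewrite mulrC.
    apply: (integrableRM (c := 3 / 2 * A + 3 / 2 * A)) => // [|w].
      exact: measurable_funB.
    by rewrite (le_trans (ler_normB _ _))// lerD// fc.
  - move=> w _; case: andP => [[]|_].
      rewrite ler_norml => /andP[D1 D2] /andP[uW Wu]; rewrite mulr1 expr2.
      by rewrite /f !clamp_id ?ler_norml//; lra.
    rewrite mulr0; have [WW'|/ltW WW'] := leP (W' w) (W w).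
      by rewrite mulr_ge0 ?subr_ge0// clamp_nd// lerB// lerB.
    by rewrite mulr_le0 ?subr_le0// clamp_nd// lerB// lerB.
rewrite (stein_identity_in mf fc) mulNr -mulrN.
apply: (@le_trans _ _ (2 * (3 / 2 * A * E (fun w => `|S w|)))).
  rewrite ler_wpM2l// (le_trans (ler_norm _))// normrN.
  rewrite (le_trans (le_normr_Rintegral _ _))//.
  rewrite -RintegralZl//; last exact: integrableR_norm.
  apply: le_Rintegral => //.
  - exact: integrableR_norm.
  - by apply: integrableRZ; exact: integrableR_norm.
  - by move=> w _; rewrite normrM ler_wpM2r// fc.
have -> : 2 * (3 / 2 * A * E (fun w => `|S w|)) = 3 * A * E (fun w => `|S w|) by field.
rewrite ler_wpM2l ?mulr_ge0 ?(ltW A0)//.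
rewrite -RintegralZl//; last exact: integrableR_norm.
have i1 : integrableR (fun w => lambda * `|psi (W w)|).
  by apply: integrableRZ; exact: integrableR_norm.
have i2 : integrableR (fun w => `|r (W w)|) by exact: integrableR_norm.
rewrite -RintegralD//.
apply: le_Rintegral => //.
- exact: integrableR_norm.
- exact: integrableRD.
- by move=> w _; rewrite (le_trans (ler_normB _ _))// normrM (gtr0_norm hlambda).
Qed.

(** The lower bound uses concentration on [[z, z + A]], the upper bound on
[[z - A, z]]. *)
Lemma kolmogorov_remainder (d1 d2 d3 d4 z A : R) : assumption_B2 I p d1 d2 d3 d4 ->
  0 < A ->
  `|E (fun w => (W w - W' w) ^+ 2 * stein_solution_le_deriv I p z (W w)
      - (W w - W' w) * (stein_solution_le I p z (W w) - stein_solution_le I p z (W' w)))|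
  <= d3 * E (fun w => (W w - W' w) ^+ 2 * (A <= `|W w - W' w|)%R%:R)
     + d4 / 2 * A ^+ 3
     + 3 * A * (lambda * E (fun w => `|psi (W w)|) + E (fun w => `|r (W w)|)).
Proof.
move=> hB A0; pose f := stein_solution_le I p z; pose f1 := stein_solution_le_deriv I p z.
pose D w := W w - W' w.
pose K u w := D w ^+ 2 * ((`|D w| <= A) && (u <= W w <= u + A))%R%:R.
pose L w := D w ^+ 2 * (A <= `|D w|)%R%:R.
have mD : measurable_fun setT D by exact: integrableR_measurable iD.
have mD2 : measurable_fun setT (fun w => D w ^+ 2) by exact: integrableR_measurable iD2.
have mN : measurable_fun setT (fun w => `|D w|) by exact: measurableT_comp.
have iind (t : T -> bool) : measurable_fun setT t -> integrableR (fun w => D w ^+ 2 * (t w)%:R).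
  move=> mt; apply: (integrableR_le _ iD2).
    by apply: measurable_funM => //; exact: measurable_natb.
  by move=> w; rewrite normrM ler_piMr// normr_nat lern1 leq_b1.
have iL : integrableR L by apply: iind; exact: measurable_fun_ler.
have iK u : integrableR (K u).
  apply: iind; apply: measurable_and; first exact: measurable_fun_ler.
  by apply: measurable_and; apply: measurable_fun_ler.
pose e w := d3 * L w + d4 / 2 * A ^+ 3.
have ie : integrableR e.
  by apply: integrableRD; [exact: integrableRZ|exact: integrableR_cst].
have Ee : E e = d3 * E L + d4 / 2 * A ^+ 3.
  rewrite RintegralD//; [|exact: integrableRZ|exact: integrableR_cst].
  by rewrite RintegralZl// Rintegral_cst// [X in fine X]probability_setT /= mulr1.
set X := (fun w => _).
have iX : integrableR X.
  have mf : measurable_fun I f.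
    exact: (stein_solution_le_measurable z hD).
  have mf1 : measurable_fun I f1 by exact: (stein_solution_le_deriv_measurable z hD).
  have [fc f1c _ _] := hB z.
  apply: integrableRB.
    under eq_fun do rewrite mulrC.
    apply: (integrableRM (c := d2)) => //; first exact: (measurable_in mW hWI).
    by move=> w; exact: f1c.
  under eq_fun do rewrite mulrC.
  apply: (integrableRM (c := d1 + d1)) => //.
    by apply: measurable_funB; [exact: (measurable_in mW hWI)|exact: (measurable_in mW' hW'I)].
  by move=> w; rewrite (le_trans (ler_normB _ _))// lerD// fc.
have bnd w := kolmogorov_pointwise z hD hB A0 (hWI w) (hW'I w).
have EK u : E (K u) <= 3 * A * (lambda * E (fun w => `|psi (W w)|) + E (fun w => `|r (W w)|)).
  exact: concentration.
rewrite -Ee ler_norml; apply/andP; split.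
  apply: (@le_trans _ _ (- (E e + E (K z)))).
    by rewrite lerN2 lerD2l; exact: EK.
  have ieK : integrableR (fun w => e w + K z w) by exact: integrableRD.
  have -> : - (E e + E (K z)) = E (fun w => -1 * (e w + K z w)).
    rewrite [RHS]RintegralZl// mulN1r; congr (- _).
    by apply: esym; exact: (RintegralD measurableT ie (iK z)).
  apply: le_Rintegral => //; first exact: integrableRZ.
  by move=> w _; have /andP[+ _] := bnd w; rewrite mulN1r.
apply: (@le_trans _ _ (E e + E (K (z - A)))); last by rewrite lerD2l; exact: EK.
have <- : E (fun w => e w + K (z - A) w) = E e + E (K (z - A)).
  exact: (RintegralD measurableT ie (iK (z - A))).
apply: le_Rintegral => //; first exact: integrableRD.
by move=> w _; have /andP[_ +] := bnd w.
Qed.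

Lemma kolmogorov_bound (d1 d2 d3 d4 z A : R) : assumption_B2 I p d1 d2 d3 d4 ->
  0 < A -> integrableR (fun w => r (W w) ^+ 2) ->
  integrableR (fun w => (1 - (2 * lambda)^-1 * V w) ^+ 2) ->
  `|E (fun w => \1_(`]-oo, z] : set R) (W w) - density_mean I p (\1_(`]-oo, z] : set R)))| <=
   d2 * Num.sqrt (E (fun w => (1 - (2 * lambda)^-1 * V w) ^+ 2))
   + (d1 + 3 / 2 * A) * (Num.sqrt (E (fun w => r (W w) ^+ 2)) / lambda)
   + lambda^-1 * (d4 * A ^+ 3 / 4)
   + 3 * A / 2 * E (fun w => `|psi (W w)|)
   + d3 / (2 * lambda) *
     E (fun w => (W w - W' w) ^+ 2 * (A <= `|W w - W' w|)%R%:R).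
Proof.
move=> hB A0 ir2 iV2.
pose f := stein_solution_le I p z; pose f1 := stein_solution_le_deriv I p z.
have mf : measurable_fun I f.
  exact: (stein_solution_le_measurable z hD).
have mf1 : measurable_fun I f1 by exact: (stein_solution_le_deriv_measurable z hD).
have [fc f1c _ _] := hB z.
have := stein_bound mf fc mf1 f1c ir2.
rewrite (_ : E (fun w => f1 (W w) + _) = E (fun w => \1_(`]-oo, z] : set R) (W w)
   - density_mean I p (\1_(`]-oo, z] : set R)))); last first.
  by apply: eq_Rintegral => w _; rewrite /f1 (stein_solution_le_derivE z hD (hWI w)) subrK.
move=> /le_trans; apply.
have rem := kolmogorov_remainder z hB A0.
have d20 : 0 <= d2.
  have [w _] := probability_inhabited P.
  exact: le_trans (normr_ge0 _) (f1c _ (hWI w)).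
have l0 : 0 <= (2 * lambda)^-1 by rewrite invr_ge0 mulr_ge0// ltW.
have iV1 : integrableR (fun w => 1 - (2 * lambda)^-1 * V w).
  by apply: integrableRB; [exact: integrableR_cst|exact: integrableRZ].
have sV := ler_wpM2l d20 (Rintegral_abs_le_sqrt iV1 iV2).
have sR := Rintegral_abs_le_sqrt ir ir2.
set sqV := Num.sqrt _ in sV *; set sqR := Num.sqrt _ in sR *.
have {}rem := ler_wpM2l l0 (le_trans rem (lerD (lexx _) (ler_wpM2l _ (lerD (lexx _) sR)))).
apply: le_trans (lerD (lerD sV (rem _)) (lexx _)) _; first by rewrite mulr_ge0// ltW.
rewrite le_eqVlt; apply/orP; left; apply/eqP.
by field; rewrite gt_eqF.
Qed.


Lemma lipschitz_integrable (h : R -> R) (k : R) :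
  (forall x y, I x -> I y -> `|h x - h y| <= k * `|x - y|) ->
  integrableR (fun w => h (W w)).
Proof.
move=> hk; have iW := exchangeable_integrable mW mW' exch reg.
have mh : measurable_fun I h.
  exact: (subspace_continuous_measurable_fun mI (lipschitz_continuous_in hk)).
have [w0 _] := probability_inhabited P.
apply: (@integrableR_le _ _ _ _ _ (fun w => `|h (W w0)| + `|k| * `|W w - W w0|)).
- exact: (measurable_in mW hWI).
- apply: integrableRD; first exact: integrableR_cst.
  apply: integrableRZ; apply: integrableR_norm.
  by apply: integrableRB => //; exact: integrableR_cst.
- move=> w; rewrite [leRHS]ger0_norm ?addr_ge0 ?mulr_ge0//.
  rewrite -lerBlDl (le_trans (lerB_dist _ _))// (le_trans (hk _ _ (hWI w) (hWI w0)))//.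
  by rewrite ler_wpM2r// ler_norm.
Qed.

(** Here the remainder is at most [c3 K / 2 * |W - W'| ^+ 3], since [f_h'] is
[c3 K]-Lipschitz. *)
Lemma smooth_bound (c1 c2 c3 k K : R) (h : R -> R) : assumption_B1 I p c1 c2 c3 ->
  (forall x y, I x -> I y -> `|h x - h y| <= k * `|x - y|) ->
  integrable_against I p h -> deriv_norm I h = K%:E ->
  integrableR (fun w => `|W w - W' w| ^+ 3) ->
  integrableR (fun w => r (W w) ^+ 2) ->
  `|E (fun w => h (W w) - density_mean I p h)| <=
  (c2 * E (fun w => `|1 - (2 * lambda)^-1 * V w|)
   + c3 / (4 * lambda) * E (fun w => `|W w - W' w| ^+ 3)
   + c1 / lambda * Num.sqrt (E (fun w => r (W w) ^+ 2))) * K.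
Proof.
move=> hB hk ih hK iD3 ir2.
pose f := stein_solution I p h; pose f1 := deriv_in I f.
have hoo : (deriv_norm I h < +oo)%E by rewrite hK ltry.
have [supf [[df supf1] [acf1 aef1 dnf1]]] :
    (sup_norm I f <= c1%:E * deriv_norm I h)%E /\
    [/\ forall x, I x -> derivable_in I f x &
        (sup_norm I f1 <= c2%:E * deriv_norm I h)%E] /\
    [/\ abs_continuous_in I f1,
        {ae lebesgue_measure, forall x, I x -> derivable_in I f1 x} &
        (deriv_norm I f1 <= c3%:E * deriv_norm I h)%E].
  exact: (hB h (lipschitz_abs_continuous hI hk) ih hoo).
rewrite hK -!EFinM in supf supf1 dnf1.
have /subspace_continuousP ch := lipschitz_continuous_in hk.
have f1E x : I x -> f1 x = h x - density_mean I p h - psi x * f x.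
  by move=> Ix; have [] := stein_equation hD ih Ix (ch _ Ix).
have cf : {within I, continuous f}.
  by apply/subspace_continuousP => x Ix; exact: slope_cvg_continuous (deriv_inP (df _ Ix)).
have f1_lip : forall x y, I x -> I y -> `|f1 y - f1 x| <= c3 * K * `|y - x|.
  apply: (lipschitz_of_abs_continuous hI acf1 aef1) => x Ix dx.
  rewrite -lee_fin; apply: le_trans dnf1.
  by apply: ereal_sup_ubound; exists x.
have mf : measurable_fun I f by exact: (subspace_continuous_measurable_fun mI cf).
have mf1 : measurable_fun I f1.
  apply: (subspace_continuous_measurable_fun mI).
  apply: (lipschitz_continuous_in (k := c3 * K)) => x y Ix Iy.
  exact: f1_lip.
have fc x (Ix : I x) := sup_norm_le supf Ix.
have f1c x (Ix : I x) := sup_norm_le supf1 Ix.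
have := stein_bound mf fc mf1 f1c ir2.
rewrite (_ : E (fun w => f1 (W w) + _) = E (fun w => h (W w) - density_mean I p h)); last first.
  by apply: eq_Rintegral => w _; rewrite f1E// subrK.
move=> /le_trans; apply.
have rem w : `|(W w - W' w) ^+ 2 * f1 (W w) - (W w - W' w) * (f (W w) - f (W' w))|
    <= c3 * K / 2 * `|W w - W' w| ^+ 3.
  set x := W w; set y := W' w.
  have -> : (x - y) ^+ 2 * f1 x - (x - y) * (f x - f y) =
      (x - y) * (f y - f x - f1 x * (y - x)) by ring.
  rewrite normrM exprS mulrCA ler_wpM2l// real_normK ?num_real//.
  have -> : (x - y) ^+ 2 = (y - x) ^+ 2 by ring.
  apply: (taylor_of_lipschitz_deriv hI (z := 0) cf) => //.
  - by move=> t It _; exact: deriv_inP (df _ It).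
  - exact: hWI.
  - exact: hW'I.
have iK3 : integrableR (fun w => c3 * K / 2 * `|W w - W' w| ^+ 3) by exact: integrableRZ.
have mX : measurable_fun setT
  (fun w => (W w - W' w) ^+ 2 * f1 (W w) - (W w - W' w) * (f (W w) - f (W' w))).
  have mDl : measurable_fun setT (fun w => W w - W' w) by exact: integrableR_measurable iD.
  apply: measurable_funB; apply: measurable_funM => //.
  - exact: integrableR_measurable iD2.
  - exact: (measurable_in mW hWI).
  - by apply: measurable_funB; [exact: (measurable_in mW hWI)|exact: (measurable_in mW' hW'I)].
have iX : integrableR
  (fun w => (W w - W' w) ^+ 2 * f1 (W w) - (W w - W' w) * (f (W w) - f (W' w))).
  by apply: (integrableR_le mX iK3) => t; exact: le_trans (rem t) (ler_norm _).
have M3 : `|E (fun w => (W w - W' w) ^+ 2 * f1 (W w)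
                          - (W w - W' w) * (f (W w) - f (W' w)))| <=
    c3 * K / 2 * E (fun w => `|W w - W' w| ^+ 3).
  rewrite (le_trans (le_normr_Rintegral _ _))//.
  rewrite -RintegralZl//; apply: le_Rintegral => //.
  exact: integrableR_norm.
have l0 : 0 <= (2 * lambda)^-1 by rewrite invr_ge0 mulr_ge0// ltW.
apply: le_trans (lerD (lerD (lexx _) (ler_wpM2l l0 M3)) (lexx _)) _.
rewrite le_eqVlt; apply/orP; left; apply/eqP.
by field; rewrite gt_eqF.
Qed.

End stein_bounds.

Theorem theorem4p6 (R : realType) (a b : \bar R) (I : set R) (p : R -> R)
    (d d' : measure_display) (T : measurableType d) (T' : measurableType d')
    (P : probability T R) (Q : probability T' R)
    (W W' : {RV P >-> R}) (Z : {RV Q >-> R})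
    (r : R -> R) (lambda : R) (V : T -> R)
    (hD : assumption_D a b I p)
    (hWI : forall w, I (W w)) (hW'I : forall w, I (W' w))
    (hexch : exchangeable_pair P W W')
    (hr : measurable_fun setT r)
    (hlambda : 0 < lambda < 1)
    (hreg : is_cond_expectation P W W'
       (fun w => W w + lambda * score I p (W w) - r (W w)))
    (* V is any version of E[(W - W')^2 | W] *)
    (hV : is_cond_expectation P W (fun w => (W w - W' w) ^+ 2) V)
    (hWpsi : P.-integrable setT (fun w => (W w * score I p (W w))%:E))
    (hWr : P.-integrable setT (fun w => (W w * r (W w))%:E))
    (hZ : has_density Z I p) :
  'Er_P[fun w => (W w - W' w) ^+ 2] =
    - 2 * lambda * 'Er_P[fun w => W w * score I p (W w)]
    + 2 * 'Er_P[fun w => W w * r (W w)]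
  /\
  (forall c1 c2 c3 : R, assumption_B1 I p c1 c2 c3 ->
    P.-integrable setT (fun w => (`|W w - W' w| ^+ 3)%:E) ->
    P.-integrable setT (fun w => (r (W w) ^+ 2)%:E) ->
    forall h : R -> R, [lipschitz h x | x in I] ->
    let delta :=
      c2 * 'Er_P[fun w => `|1 - (2 * lambda)^-1 * V w|]
      + c3 / (4 * lambda) * 'Er_P[fun w => `|W w - W' w| ^+ 3]
      + c1 / lambda * Num.sqrt 'Er_P[fun w => r (W w) ^+ 2] in
    (`|'E_P[h \o W] - 'E_Q[h \o Z]| <= delta%:E * deriv_norm I h)%E)
  /\
  (forall d1 d2 d3 d4 : R, assumption_B2 I p d1 d2 d3 d4 ->
    P.-integrable setT (fun w => (r (W w) ^+ 2)%:E) ->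
    P.-integrable setT (fun w => ((1 - (2 * lambda)^-1 * V w) ^+ 2)%:E) ->
    forall A : R, 0 < A ->
    (kolmogorov_distance W Z <=
      (d2 * Num.sqrt 'Er_P[fun w => (1 - (2 * lambda)^-1 * V w) ^+ 2]
       + (d1 + 3 / 2 * A)
         * (Num.sqrt 'Er_P[fun w => r (W w) ^+ 2] / lambda)
       + lambda^-1 * (d4 * A ^+ 3 / 4)
       + 3 * A / 2 * 'Er_P[fun w => `|score I p (W w)|]
       + d3 / (2 * lambda)
         * 'Er_P[fun w => (W w - W' w) ^+ 2
                          * (A <= `|W w - W' w|)%R%:R])%:E)%E).
Proof.
have [lambda0 _] := andP hlambda.
have [iW' iV' _ _] := hreg; have [iD2 iV _ _] := hV.
have mW : measurable_fun setT W by [].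
have mW' : measurable_fun setT W' by [].
have reg : is_cond_expectation P W W'
    (fun w => W w + (lambda * score I p (W w) - r (W w))).
  rewrite (_ : (fun w => _) = fun w => W w + lambda * score I p (W w) - r (W w))//.
  by apply/funext => w; rewrite addrA.
have hI : interval_with_endpoints a b I by case: hD.
have ErE (X : T -> R) : 'Er_P[X] = \int[P]_w X w.
  by rewrite /real_expectation unlock.
have r_int : P.-integrable setT (fun w => (r (W w) ^+ 2)%:E) ->
    P.-integrable setT (fun w => (r (W w))%:E).
  move=> ir2.
  apply: (integrableR_le (Y := fun w => 1 + r (W w) ^+ 2)).
  - exact: measurableT_comp.
  - by apply: integrableRD => //; exact: integrableR_cst.
  - move=> w; rewrite [leRHS]ger0_norm ?addr_ge0 ?sqr_ge0//.
    rewrite -(real_normK (num_real (r (W w)))); have := normr_ge0 (r (W w)).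
    have := sqr_ge0 (`|r (W w)| - 1); nra.
split; last split.
- rewrite !ErE.
  have iWS : P.-integrable setT (fun w => (W w * (lambda * score I p (W w) - r (W w)))%:E).
    rewrite (_ : (fun w => _) =
      fun w => (lambda * (W w * score I p (W w)) - W w * r (W w))%:E); last first.
      by apply/funext => w; congr EFin; ring.
    by apply: integrableRB => //; exact: integrableRZ.
  rewrite (exchangeable_second_moment mW mW' hexch reg iD2 iWS).
  have -> : \int[P]_w (W w * (lambda * score I p (W w) - r (W w))) =
      lambda * \int[P]_w (W w * score I p (W w)) - \int[P]_w (W w * r (W w)).
    rewrite -RintegralZl// -RintegralB//; last exact: integrableRZ.
    by apply: eq_Rintegral => w _; ring.
  by ring.
- move=> c1 c2 c3 hB1 iD3 ir2 h [k [_ hk]] /=.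
  have {}hk x y : I x -> I y -> `|h x - h y| <= (`|k| + 1) * `|x - y|.
    move=> Ix Iy; have /hk : k < `|k| + 1 by have := ler_norm k; lra.
    by move=> /(_ (x, y)); apply.
  have ih := B1_lipschitz_integrable hD hB1 hk.
  have [x0 [_ [_ [Ix0 _ _ _]]]] := interval_three_points hI.
  have [K K0 hK] := B1_deriv_norm hD hB1 Ix0 ih hk.
  have ihW := lipschitz_integrable hD hWI hexch hreg hk.
  have := smooth_bound hD hWI hW'I hexch lambda0 hreg hV (r_int ir2) hB1 hk ih hK iD3 ir2.
  rewrite RintegralB//; last exact: integrableR_cst.
  rewrite Rintegral_cst// [X in fine X]probability_setT /= mulr1 => bound.
  rewrite !ErE hK unlock.
  have mh : measurable_fun I h by case: ih.
  have -> : (\int[Q]_w ((h \o Z) w)%:E = (density_mean I p h)%:E)%E.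
    rewrite (integral_has_density hD hZ mh) /density_mean /Rintegral fineK//.
    by apply: integrable_fin_num; [exact: interval_measurable hI|case: ih].
  rewrite -[X in (X - _)%E]fineK; last exact: integrable_fin_num.
  by rewrite -EFinB -EFinM lee_fin.
- move=> d1 d2 d3 d4 hB2 ir2 iV2 A A0.
  apply: ge_ereal_sup => _ [z _ <-]; rewrite !ErE.
  have := kolmogorov_bound hD hWI hW'I hexch lambda0 hreg hV (r_int ir2) z hB2 A0 ir2 iV2.
  have ihW : P.-integrable setT (fun w => (\1_(`]-oo, z] : set R) (W w) : R)%:E).
    apply: (@integrableR_bounded _ _ _ P _ 1) => [|w]; last exact: indic_ray_le1.
    by apply: measurableT_comp => //; exact: measurable_indic.
  rewrite RintegralB//; last exact: integrableR_cst.
  rewrite Rintegral_cst// [X in fine X]probability_setT /= mulr1 => bound.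
  have cdfW : cdf W z = (\int[P]_w (\1_(`]-oo, z] : set R) (W w) : R))%:E.
    rewrite /Rintegral fineK; last exact: integrable_fin_num.
    have mA : measurable (W @^-1` `]-oo, z]) by rewrite -[X in measurable X]setTI; exact: mW.
    rewrite (eq_integral (fun w => (\1_(W @^-1` `]-oo, z]) w)%:E))//.
    by rewrite integral_indic// setIT.
  have cdfZ : cdf Z z = (density_mean I p (\1_(`]-oo, z] : set R)))%:E.
    have [_ i1] := indic_ray_integrable z hD.
    rewrite /density_mean /Rintegral fineK; last first.
      by apply: integrable_fin_num => //; exact: interval_measurable hI.
    rewrite /cdf hZ// integral_mkcondl; apply: eq_integral => x _.
    by rewrite patchE indicE; case: ifP => _; rewrite ?mul1r ?mul0r.
  by rewrite cdfW cdfZ -EFinB abse_EFin lee_fin.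
Qed.
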